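(* In the setting of the context, assume there exist $\phi_1,\dots,\phi_k\in\mathbb H$ such that 1. $\mathcal I\phi_i=\psi_i$ for all $i\le k$; 2. $\max_{i\le k}\|\phi_i-P_{E_D}\phi_i\|_{\mathbb H}\,/\,\lambda_{\min}(\mathcal I_D)\to0$ as $N\to\infty$; 3. $\mathbb I_{\theta_0}$ is injective on $\mathrm{span}\{\phi_1,\dots,\phi_k\}$. Then $i_D^{-1}\to L$ as $N\to\infty$, where $L\in\mathbb R^{k\times k}$, $L_{ij}=\langle\phi_i,\psi_j\rangle_{\mathbb H}$. Assume further that $$\mathcal L\big(\sqrt N\,i_D^{1/2}(\Psi\theta_N-\hat\Psi_N)\mid\mathcal D_N\big)\to\mathcal N(0,I_k)\ \text{weakly in }\mathbb P_{\theta_0}\text{-probability}\quad\text{and}\quad\sqrt N\,i_D^{1/2}(\hat\Psi_N-\Psi\theta_0)\to\mathcal N(0,I_k)\ \text{in distribution under }\mathbb P_{\theta_0}.$$ Then $$\mathcal L\big(\sqrt N(\Psi\theta_N-\hat\Psi_N)\mid\mathcal D_N\big)\to\mathcal N(0,L)\ \text{weakly in }\mathbb P_{\theta_0}\text{-probability}\quad\text{and}\quad\sqrt N(\hat\Psi_N-\Psi\theta_0)\to\mathcal N(0,L)\ \text{in distribution under }\mathbb P_{\theta_0}.$$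
   Context: Model. $\mathcal X\subset\mathbb R^d$ is a Borel set of positive finite Lebesgue measure with uniform distribution $\lambda_{\mathcal X}$; $\mathbb H$ is a Hilbert space with orthonormal basis $\{e_i\}_{i\in\mathbb N}$; $\Theta$ is a linear subspace of $\mathbb H$ containing $\mathrm{span}\{e_i\}_{i\in\mathbb N}$; $(V,\langle\cdot,\cdot\rangle_V)$ is a finite-dimensional inner product space; $L^2(\mathcal X;V)$ is the space of $V$-valued functions square integrable with respect to $\lambda_{\mathcal X}$; $\mathcal G:\Theta\to L^2(\mathcal X;V)$ is measurable, $\mathcal G_\theta:=\mathcal G(\theta)$. Observations $Y_i=\mathcal G_\theta(X_i)+\varepsilon_i$, with $X_i\sim\lambda_{\mathcal X}$, $\varepsilon_i$ centered Gaussian on $V$ with identity covariance operator, all $X_i,\varepsilon_i$ independent. Fix $\theta_0\in\Theta$; $\mathbb P_{\theta_0}$ is the law of the i.i.d. sequence $(X_i,Y_i)_{i\in\mathbb N}$ under $\theta=\theta_0$; $\mathcal D_N=((X_i,Y_i))_{i\le N}$. Fix linearly independent $\psi_1,\dots,\psi_k\in\mathbb H$ and let $\Psi\theta=(\langle\theta,\psi_i\rangle_{\mathbb H})_{i\le k}\in\mathbb R^k$. Prior and posterior. $E_D=\mathrm{span}\{e_1,\dots,e_D\}$ with $D=D(N)\to\infty$ as $N\to\infty$; $P_{E_D}:\mathbb H\to E_D$ is the orthogonal projection. $\langle\cdot,\cdot\rangle_{\mathcal H_N}$ is an inner product on $E_D$ and the prior $\Pi_N$ is the centered Gaussian measure on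 $(E_D,\langle\cdot,\cdot\rangle_{\mathcal H_N})$ with identity covariance operator. With $\ell_N(\theta)=-\frac12\sum_{i=1}^N\|Y_i-\mathcal G_\theta(X_i)\|_V^2$, the posterior $\Pi_N(\cdot\mid\mathcal D_N)$ is the probability measure on $E_D$ with $\Pi_N$-density proportional to $e^{\ell_N}$. $\mathcal L(f(\theta_N,\mathcal D_N)\mid\mathcal D_N)$ and $\mathbb E[f(\theta_N,\mathcal D_N)\mid\mathcal D_N]$ denote the law and mean of $f(\theta_N,\mathcal D_N)$ when $\theta_N\sim\Pi_N(\cdot\mid\mathcal D_N)$. $\hat\Psi_N=\mathbb E[\Psi\theta_N\mid\mathcal D_N]$ (it exists). Random laws $\mu_N$ on $\mathbb R^k$ converge weakly to $\mu$ in $\mathbb P_{\theta_0}$-probability if $d_{\mathrm{BL}}(\mu_N,\mu)\to0$ in $\mathbb P_{\theta_0}$-probability, $d_{\mathrm{BL}}$ being the bounded Lipschitz metric. Linearization. Standing assumptions: there is a bounded linear operator $\mathbb I_{\theta_0}:\mathbb H\to L^2(\mathcal X;V)$ such that for every $h\in\Theta$, $\|\mathcal G(\theta_0+\epsilon h)-\mathcal G(\theta_0)-\epsilon\,\mathbb I_{\theta_0}[h]\|_{L^2}=o(\epsilon)$ as $\epsilon\to0$; and, with $\mathcal I=\mathbb I_{\theta_0}^*\mathbb I_{\theta_0}$ (the information operator), the operator $\mathcal I_D=P_{E_D}\mathcal I|_{E_D}:E_D\to E_D$ is invertible for all $D\in\mathbb N$. $\lambda_{\min}(\mathcal I_D)$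 is its smallest eigenvalue. $[\mathcal I_D]\in\mathbb R^{D\times D}$ is the matrix $[\mathcal I_D]_{ij}=\langle\mathcal I_De_i,e_j\rangle_{\mathbb H}$, $\mathcal J_D\in\mathbb R^{k\times D}$ is $(\mathcal J_D)_{ij}=\langle\psi_i,e_j\rangle_{\mathbb H}$, and $i_D=\big(\mathcal J_D[\mathcal I_D]^{-1}\mathcal J_D^\top\big)^{-1}\in\mathbb R^{k\times k}$, which is well defined and symmetric positive definite for $D$ large enough. *)

(* Defs.v *)
From HB Require Import structures.
From mathcomp Require Import all_boot all_order all_algebra.
From mathcomp Require Import all_classical all_reals all_analysis.
Import Order.TTheory GRing.Theory Num.Theory numFieldNormedType.Exports.

Set Implicit Arguments.
Unset Strict Implicit.
Unset Printing Implicit Defensive.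

Local Open Scope classical_set_scope.
Local Open Scope ring_scope.

Notation borel T := (g_sigma_algebraType (@open T)).

(* R^n with its product sigma-algebra, which is the Borel one. *)
Notation Rn R n := (n.-tuple (measurableTypeR R)).

Section power_measure.
Context d (T : measurableType d) (R : realType).

Section cons.
Variables (n : nat) (mu : {sigma_finite_measure set T -> \bar R}).
Variable nu : {sigma_finite_measure set (n.-tuple T) -> \bar R}.

Let tcons (x : T * n.-tuple T) := [the n.+1.-tuple T of x.1 :: x.2].

Let measurable_tcons : measurable_fun [set: T * n.-tuple T] tcons.
Proof. exact: measurable_cons. Qed.

Definition mcons : set (n.+1.-tuple T) -> \bar R :=
  pushforward (mu \x nu)%E tcons.

Let mcons0 : mcons set0 = 0%E.
Proof. by rewrite /mcons /pushforward preimage_set0 measure0. Qed.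

Let mcons_ge0 A : (0 <= mcons A)%E.
Proof. exact: measure_ge0. Qed.

Let mcons_sigma_additive : semi_sigma_additive mcons.
Proof.
move=> F mF tF mUF; rewrite /mcons /pushforward preimage_bigcup.
apply: measure_semi_sigma_additive.
- by move=> i; rewrite -[X in measurable X]setTI; exact: measurable_tcons.
- apply/trivIsetP => /= i j _ _ ij; rewrite -preimage_setI.
  by move/trivIsetP : tF => /(_ _ _ _ _ ij) ->//; rewrite preimage_set0.
- by rewrite -preimage_bigcup -[X in measurable X]setTI;
    exact: measurable_tcons.
Qed.

HB.instance Definition _ := isMeasure.Build _ _ _ mcons
  mcons0 mcons_ge0 mcons_sigma_additive.

Let mcons_sigma_finite : sigma_finite setT mcons.
Proof.
have /sigma_finiteP[F [TF ndF Foo]] := sigma_finiteT mu.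
have /sigma_finiteP[G [TG ndG Goo]] := sigma_finiteT nu.
pose u (t : n.+1.-tuple T) : T * n.-tuple T := (thead t, [tuple of behead t]).
have uK : cancel tcons u.
  by move=> [x t]; congr pair; apply/val_inj.
have mu_ : measurable_fun setT u.
  apply: measurable_fun_pair; last exact: measurable_behead.
  exact: measurable_tnth.
exists (fun i => u @^-1` (F i `*` G i)).
  rewrite -preimage_bigcup (_ : \bigcup_i _ = setT) ?preimage_setT//.
  rewrite -subTset => -[x t] _.
  have [i _ Fx] : (\bigcup_i F i) x by rewrite -TF.
  have [j _ Gt] : (\bigcup_i G i) t by rewrite -TG.
  exists (maxn i j) => //; split => /=.
    by move: x Fx; exact/subsetPset/ndF/leq_maxl.
  by move: t Gt; exact/subsetPset/ndG/leq_maxr.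
move=> i; have [mFi Fioo] := Foo i; have [mGi Gioo] := Goo i.
split; first by rewrite -[X in measurable X]setTI; apply: mu_ => //; exact: measurableX.
rewrite /mcons /pushforward -comp_preimage (_ : u \o tcons = id); last exact/funext.
by rewrite preimage_id product_measure1E// lte_mul_pinfty// ge0_fin_numE.
Qed.

HB.instance Definition _ :=
  Measure_isSigmaFinite.Build _ _ _ mcons mcons_sigma_finite.

End cons.

(* the n-fold product measure *)
Fixpoint mpow (mu : {sigma_finite_measure set T -> \bar R}) n :
    {sigma_finite_measure set (n.-tuple T) -> \bar R} :=
  if n is m.+1 then mcons mu (mpow mu m) else \d_ [tuple].

End power_measure.

Section hilbert.
Context (R : realType).

Definition lin_span (W : lmodType R) n (b : 'I_n -> W) : set W :=
  [set x | exists c : 'I_n -> R, x = \sum_i c i *: b i].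

Definition lin_indep (W : lmodType R) n (b : 'I_n -> W) :=
  forall c : 'I_n -> R, \sum_i c i *: b i = 0 -> forall i, c i = 0.

Definition linear_subspace (W : lmodType R) (E : set W) :=
  E 0 /\ forall (a : R) x y, E x -> E y -> E (a *: x + y).

Definition inner_product_on (W : lmodType R) (E : set W) (ip : W -> W -> R) :=
  [/\ forall (a : R) x y z, E x -> E y -> E z ->
        ip (a *: x + y) z = a * ip x z + ip y z,
      forall x y, E x -> E y -> ip x y = ip y x
    & forall x, E x -> x != 0 -> 0 < ip x x].

Context (H : completeNormedModType R) (dotH : {dot H for idfun}).

Definition ED (e : nat -> H) (D : nat) : set H := lin_span (fun i : 'I_D => e i).

Definition orthonormal_basis (e : nat -> H) :=
  (forall i j, dotH (e i) (e j) = (i == j)%:R) /\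
  closure (\bigcup_D ED e D) = setT.

(* orthogonal projection onto ED e D, for e orthonormal *)
Definition PE (e : nat -> H) (D : nat) (h : H) : H :=
  \sum_(i < D) dotH h (e i) *: e i.

End hilbert.

Section gaussian.
Context (R : realType).

Definition std_normal n : set (Rn R n) -> \bar R :=
  mpow (normal_prob (0 : R) 1) n.

(* mu is the centered Gaussian law with identity covariance operator on the
   finite-dimensional inner product space (E, ip): the law of
   sum_i g_i b_i with g_i i.i.d. N(0,1) and b an orthonormal basis of E *)
Definition std_gaussian_on (W : normedModType R) (E : set W) (ip : W -> W -> R)
    (mu : set (borel W) -> \bar R) :=
  exists n (b : 'I_n -> W),
    [/\ lin_span b = E,
        forall i j, ip (b i) (b j) = (i == j)%:R
      & forall A : set (borel W), measurable A ->
          mu A = std_normal [set t : Rn R n |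
                              A (\sum_i (tnth t i : R) *: b i)] ].

(* the symmetric positive semidefinite square root *)
Definition mxsqrt k (S : 'M[R]_k) : 'M[R]_k :=
  get [set Q : 'M[R]_k | [/\ Q^T = Q,
    forall u : 'cV[R]_k, 0 <= (u^T *m Q *m u) 0 0 & Q *m Q = S]].

(* N(0, S), as the image of N(0, I_k) under S^(1/2) *)
Definition gauss k (S : 'M[R]_k) : set (borel 'cV[R]_k) -> \bar R :=
  pushforward (@std_normal k)
    (fun t => mxsqrt S *m (\col_i (tnth t i : R)) : borel 'cV[R]_k).

End gaussian.

Section weak_convergence.
Context (R : realType) (k : nat).
Implicit Types mu nu : set (borel 'cV[R]_k) -> \bar R.

Definition euclid (z : 'cV[R]_k) : R := Num.sqrt (\sum_i z i 0 ^+ 2).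

(* unit ball for max of the sup norm and the Euclidean Lipschitz constant *)
Definition BL1 : set ('cV[R]_k -> R) :=
  [set f | (forall z, `|f z| <= 1) /\
           (forall z w, `|f z - f w| <= euclid (z - w))].

Definition dBL mu nu : \bar R :=
  ereal_sup [set `| \int[mu]_z (f z)%:E - \int[nu]_z (f z)%:E |%E | f in BL1].

Context d (Omega : measurableType d) (P : probability Omega R).

(* Random laws mu N w converge to nu weakly in P-probability. The probability
   of {dBL > eps} is taken as outer probability, which is P itself on
   measurable sets, so that its measurability need not be discussed. *)
Definition weak_cvg_in_prob (mu : nat -> Omega -> set (borel 'cV[R]_k) -> \bar R)
    nu :=
  forall eps : R, 0 < eps ->
    mu_ext P [set w | (eps%:E < dBL (mu N w) nu)%E] @[N --> \oo] --> 0%E.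

Definition cvg_in_dist (Z : nat -> Omega -> 'cV[R]_k) nu :=
  forall f : 'cV[R]_k -> R, continuous f -> (exists M, forall z, `|f z| <= M) ->
    (\int[P]_w (f (Z N w))%:E)%E @[N --> \oo] --> (\int[nu]_z (f z)%:E)%E.

End weak_convergence.

(* L^2(X; V) is handled through representatives: functions on R^dim of which
   only the restriction to X matters, up to lam-almost everywhere equality. *)
Section L2.
Context (R : realType) (dim : nat) (X : set (Rn R dim)).
Context (lam : probability (Rn R dim) R).
Context (V : normedModType R) (dotV : {dot V for idfun}).
Implicit Types f g : Rn R dim -> V.

Definition isL2 f :=
  measurable_fun X (f : Rn R dim -> borel V) /\
  (\int[lam]_(x in X) (`|f x| ^+ 2)%:E < +oo)%E.

Definition dotL2 f g : R := \int[lam]_(x in X) dotV (f x) (g x).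

Definition normL2 f : R := Num.sqrt (\int[lam]_(x in X) (`|f x| ^+ 2)).

Context (H : completeNormedModType R) (dotH : {dot H for idfun}).

Definition bounded_linear_op (T : H -> Rn R dim -> V) :=
  [/\ forall h, isL2 (T h),
      forall (a : R) (h1 h2 : H),
        ae_eq lam X (T (a *: h1 + h2)) (fun x => a *: T h1 x + T h2 x)
    & exists C : R, forall h, normL2 (T h) <= C * `|h|].

(* By the Riesz theorem Tadj exists and is unique on L^2. *)
Definition is_adjoint (T : H -> Rn R dim -> V) (Tadj : (Rn R dim -> V) -> H) :=
  forall f h, isL2 f -> dotH (Tadj f) h = dotL2 f (T h).

(* measurability on the domain D, with its trace sigma-algebra (the library's
   measurable_fun is vacuous when D is not measurable) *)
Definition trace_measurable d1 (T1 : measurableType d1) (D A : set T1) :=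
  exists2 B : set T1, measurable B & D `&` A = D `&` B.

(* A measurable map G : Theta -> L^2(X; V). The pointwise values entering the
   model and the likelihood are those of a jointly measurable version, which
   a measurable map into the separable space L^2(X; V) always has; since
   L^2(X; V) is separable, its Borel sets are generated by the open balls. *)
Definition measurable_forward_map (Theta : set H) (G : H -> Rn R dim -> V) :=
  [/\ forall th, Theta th -> isL2 (G th),
      forall f (r : R), isL2 f ->
        @trace_measurable _ (borel H) Theta
          [set th | normL2 (fun x => G th x - f x) < r]
    & forall A : set (borel V), measurable A ->
        @trace_measurable _ (borel H * Rn R dim)%type (Theta `*` X)
          [set z | A (G z.1 z.2)]].

Definition linearized_at (Theta : set H) (G : H -> Rn R dim -> V) (th0 : H)
    (T : H -> Rn R dim -> V) :=
  forall h, Theta h ->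
    (normL2 (fun x => (G (th0 + eps *: h) x - G th0 x) - eps *: T h x)
       / `|eps|) @[eps --> (0 : R)^'] --> (0 : R).

End L2.

Section uniform.
Context (R : realType) (dim : nat) (X : set (Rn R dim)).

Definition lebesgue_Rn : {sigma_finite_measure set (Rn R dim) -> \bar R} :=
  mpow (@lebesgue_measure R) dim.

(* For 0 < lebesgue_Rn X < +oo this is A |-> |A `&` X| / |X|; the second
   argument of mnormalize is the value in the remaining cases. *)
Definition uniform_on (mX : measurable X) : probability (Rn R dim) R :=
  mnormalize (mrestr lebesgue_Rn mX) (\d_ point).

End uniform.

(* The design points and noise live on an arbitrary probability space
   (Omega, P); the convergences below only involve the law under P of the
   sequence of observations. *)
Section model.
Context (R : realType) d (Omega : measurableType d) (P : probability Omega R).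
Context (dim : nat) (V : normedModType R).
Context (Xs : nat -> {RV P >-> Rn R dim}) (eps : nat -> {RV P >-> borel V}).

(* mutual independence of all the Xs i and eps i; finite subfamilies are
   covered by taking some of the A i, B i equal to setT *)
Definition design_noise_independent :=
  forall n (A : nat -> set (Rn R dim)) (B : nat -> set (borel V)),
    (forall i, measurable (A i)) -> (forall i, measurable (B i)) ->
    P (\bigcap_(i in `I_n) (Xs i @^-1` A i `&` eps i @^-1` B i)) =
    (\prod_(i < n) (P (Xs i @^-1` A i) * P (eps i @^-1` B i)))%E.

Context (H : completeNormedModType R) (G : H -> Rn R dim -> V).

Definition obs (th0 : H) (i : nat) (w : Omega) : V :=
  G th0 (Xs i w) + (eps i w : V).

Definition loglik (Y : nat -> Omega -> V) (N : nat) (w : Omega) (th : H) : R :=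
  - 2^-1 * \sum_(i < N) `|Y i w - G th (Xs i w)| ^+ 2.

End model.

Section posterior.
Context (R : realType) (H : completeNormedModType R).

(* The posterior on the subspace E, seen as a law on H. *)
Definition posterior (E : set H) (Pi : probability (borel H) R) (l : H -> R) :
    set (borel H) -> \bar R :=
  fun A => ((\int[Pi]_(th in E `&` A) (expR (l th))%:E) *
            (fine (\int[Pi]_(th in E) (expR (l th))%:E))^-1%:E)%E.

Context (dotH : {dot H for idfun}) (k : nat) (psi : 'I_k -> H).

Definition Psi (th : H) : 'cV[R]_k := \col_i dotH th (psi i).

Definition PsiMean (post : set (borel H) -> \bar R) : 'cV[R]_k :=
  \col_i fine (\int[post]_th (dotH th (psi i))%:E)%E.

End posterior.

Section information.
Context (R : realType) (H : completeNormedModType R) (dotH : {dot H for idfun}).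

Definition information_op (dim : nat) (V : normedModType R)
    (T : H -> Rn R dim -> V) (Tadj : (Rn R dim -> V) -> H) (h : H) : H :=
  Tadj (T h).

Context (e : nat -> H) (I : H -> H).

Definition infoD (D : nat) (h : H) : H := PE dotH e D (I h).

(* smallest eigenvalue of infoD on ED e D; the set below is finite, and
   nonempty for D > 0, so that its infimum is its minimum *)
Definition lambda_min (D : nat) : R :=
  inf [set a | exists h, [/\ ED e D h, h != 0 & infoD D h = a *: h]].

Definition infoDmx (D : nat) : 'M[R]_D :=
  \matrix_(i, j) dotH (infoD D (e i)) (e j).

Context (k : nat) (psi : 'I_k -> H).

Definition Jmx (D : nat) : 'M[R]_(k, D) := \matrix_(i, j) dotH (psi i) (e j).

Definition iD (D : nat) : 'M[R]_k :=
  invmx (Jmx D *m invmx (infoDmx D) *m (Jmx D)^T).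

End information.

(* Main.v *)
From HB Require Import structures.
Require Import Defs.
From mathcomp Require Import all_boot all_order all_algebra.
From mathcomp Require Import all_classical all_reals all_analysis.
From mathcomp Require Import measurable_realfun.
From mathcomp Require Import ring lra.
From mathcomp Require complex.
Import Order.TTheory GRing.Theory Num.Theory numFieldNormedType.Exports.

Set Implicit Arguments.
Unset Strict Implicit.
Unset Printing Implicit Defensive.

Local Open Scope classical_set_scope.
Local Open Scope ring_scope.

(** Write I for the information operator, B(h, g) = <I h, g> for the
    symmetric nonnegative form that it defines (the squared norm B(h, h) is the
    squared L^2 norm of the linearization at h), and P for the orthogonal
    projection onto E_D.

    The limit of i_D^-1.  Since I phi_j = psi_j, the matrix L is the Gram
    matrix of phi_1, ..., phi_k for B.  Let u_j in E_D be the Galerkin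
    approximation of phi_j, given by B(phi_j - u_j, g) = 0 for all g in E_D.
    The coordinates of u_j solve a linear system whose matrix is [I_D], so that
    i_D^-1 is the Gram matrix of u_1, ..., u_k.  By orthogonality
      L_ij - (i_D^-1)_ij = B(phi_j - u_j, phi_i - P phi_i),
    and u_j is at least as close to phi_j as P phi_j for the energy norm.
    The Cauchy-Schwarz inequality and the boundedness of I bound this difference
    by a multiple of |phi_i - P phi_i| |phi_j - P phi_j|
    ([galerkin_error]), which tends to 0 because the span of the e_i is dense
    ([galerkin_cvg]).

    The rescaling.  If L c = 0, then B vanishes at the combination of the phi_i
    with coefficients c, hence I maps it to 0, hence c = 0 by independence of
    the psi_i: the limit L is invertible ([info_gram_unit]), and so is
    i_D for large N.  The square root is continuous at invertible
    semidefinite matrices ([inv_mxsqrt_cvg]), so Q_N = i_D^(-1/2) tends to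
    L^(1/2).  The two sequences of the conclusion are the images under Q_N of
    those of the hypothesis, and N(0, L) is the image of N(0, I_k) under
    L^(1/2).  It remains to pass to the limit in linear images
    ([weak_cvg_linear_image], [cvg_in_dist_linear_image]): outside a large ball,
    which has small Gaussian mass, a bounded test function f contributes little,
    and inside the ball f (Q_N z) is uniformly close to f (L^(1/2) z).

    The last step uses the posterior law and the estimator only through
    monotonicity of the integral, homogeneity and changes of variables by
    invertible matrices.  These properties hold for the lower integral against
    any nonnegative set function null at the empty set, and for functions
    without measurability. *)

(** * Square roots of semidefinite matrices *)

(** The quadratic polynomial t |-> f (t x + y) (t x + y) is nonnegative, hence has
    nonpositive discriminant. The form may be degenerate. *)
Lemma psd_form_CauchySchwarz (R : realType) (W : lmodType R) (f : W -> W -> R) :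
  (forall a x y z, f (a *: x + y) z = a * f x z + f y z) ->
  (forall x y, f x y = f y x) -> (forall x, 0 <= f x x) ->
  forall x y, f x y ^+ 2 <= f x x * f y y.
Proof.
move=> fl fC f0 x y.
have expand t : 0 <= t ^+ 2 * f x x + 2 * t * f x y + f y y.
  have := f0 (t *: x + y); rewrite fl (fC x) (fC y (_ + _)) !fl (fC y x).
  by congr (0 <= _); ring.
have [xx0|xx_neq0] := eqVneq (f x x) 0.
  have [->|xy_neq0] := eqVneq (f x y) 0; first by rewrite xx0; lra.
  have := expand (- (f y y + 1) / (2 * f x y)).
  have -> : 2 * (- (f y y + 1) / (2 * f x y)) * f x y = - (f y y + 1).
    by field; rewrite xy_neq0.
  by rewrite xx0; have := f0 y; lra.
have xx_gt0 : 0 < f x x by rewrite lt_def xx_neq0 f0.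
have := expand (- f x y / f x x).
have -> : (- f x y / f x x) ^+ 2 * f x x + 2 * (- f x y / f x x) * f x y + f y y
   = (f x x * f y y - f x y ^+ 2) / f x x by field; rewrite xx_neq0.
by rewrite pmulr_lge0 ?invr_gt0// subr_ge0.
Qed.

Lemma interpolation (F : fieldType) (s : seq F) (h : F -> F) :
  exists p : {poly F}, forall x, x \in s -> p.[x] = h x.
Proof.
elim: s => [|a s [p ps]]; first by exists 0.
have [ain|anin] := boolP (a \in s).
  by exists p => x; rewrite in_cons => /predU1P[->|]; exact: ps.
pose q := \prod_(x <- s) ('X - x%:P).
have qa : q.[a] != 0 by rewrite -[_ == _]/(root q a) root_prod_XsubC.
exists (p + ((h a - p.[a]) / q.[a])%:P * q) => x.
rewrite in_cons !hornerE => /predU1P[->|xs].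
  by rewrite divfK// addrC subrK.
have -> : q.[x] = 0 by apply/eqP; rewrite -[_ == _]/(root q x) root_prod_XsubC.
by rewrite mulr0 addr0 ps.
Qed.

Lemma horner_mx_sym (F : fieldType) k (S : 'M[F]_k.+1) (p : {poly F}) :
  S^T = S -> (horner_mx S p)^T = horner_mx S p.
Proof.
move=> Ssym; elim/poly_ind: p => [|p c IH]; first by rewrite rmorph0 trmx0.
rewrite rmorphD rmorphM/= horner_mx_X horner_mx_C linearD/= tr_scalar_mx.
rewrite trmx_mul IH Ssym; congr (_ + _).
exact/esym/comm_horner_mx.
Qed.

Section psd_matrices.
Context {R : realType}.

Definition psdmx k (Q : 'M[R]_k) :=
  Q^T = Q /\ forall u : 'cV[R]_k, 0 <= (u^T *m Q *m u) 0 0.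

Definition frob2 m n (C : 'M[R]_(m, n)) : R := \sum_i \sum_j C i j ^+ 2.

Lemma frob2_ge0 m n (C : 'M[R]_(m, n)) : 0 <= frob2 C.
Proof. by apply: sumr_ge0 => i _; apply: sumr_ge0 => j _; exact: sqr_ge0. Qed.

Lemma frob2_entry m n (C : 'M[R]_(m, n)) i j : C i j ^+ 2 <= frob2 C.
Proof.
rewrite /frob2 (bigD1 i)//= (bigD1 j)//= -addrA lerDl addr_ge0//.
  by apply: sumr_ge0 => ? _; exact: sqr_ge0.
by apply: sumr_ge0 => ? _; apply: sumr_ge0 => ? _; exact: sqr_ge0.
Qed.

Lemma frob20 m n : frob2 (0 : 'M[R]_(m, n)) = 0.
Proof.
by rewrite /frob2 big1// => i _; rewrite big1// => j _; rewrite mxE expr0n.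
Qed.

Lemma frob2_le0 m n (C : 'M[R]_(m, n)) : frob2 C <= 0 -> C = 0.
Proof.
move=> C0; apply/matrixP => i j; rewrite [RHS]mxE; apply/eqP.
rewrite -sqrf_eq0 eq_le sqr_ge0 andbT.
exact: le_trans (frob2_entry _ i j) C0.
Qed.

Lemma dotmxvE k (u v : 'cV[R]_k) : (u^T *m v) 0 0 = \sum_i u i 0 * v i 0.
Proof. by rewrite mxE; apply: eq_bigr => i _; rewrite mxE. Qed.

Lemma frob2_cV k (u : 'cV[R]_k) : (u^T *m u) 0 0 = frob2 u.
Proof.
by rewrite dotmxvE; apply: eq_bigr => i _; rewrite big_ord1 expr2.
Qed.

Lemma frob2_mul m n (C : 'M[R]_(m, n)) (v : 'cV[R]_n) :
  frob2 (C *m v) <= frob2 C * frob2 v.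
Proof.
rewrite /frob2 mulr_suml; apply: ler_sum => i _; rewrite big_ord1.
have := @psd_form_CauchySchwarz R 'cV[R]_n (fun u w => (u^T *m w) 0 0).
move=> /(_ _ _ _ (row i C)^T v); rewrite trmxK.
have -> : (row i C *m v) 0 0 = (C *m v) i 0.
  by rewrite -row_mul mxE.
have -> : (row i C *m (row i C)^T) 0 0 = \sum_j C i j ^+ 2.
  by rewrite mxE; apply: eq_bigr => j _; rewrite !mxE expr2.
rewrite frob2_cV; apply.
- by move=> a x y z; rewrite linearP/= mulmxDl -scalemxAl mxE [X in X + _]mxE.
- by move=> x y; rewrite !dotmxvE; apply: eq_bigr => j _; rewrite mulrC.
- by move=> x; rewrite frob2_cV frob2_ge0.
Qed.

Lemma euclidE k (z : 'cV[R]_k) : euclid z = Num.sqrt (frob2 z).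
Proof.
by rewrite /euclid; congr Num.sqrt; apply: eq_bigr => i _; rewrite big_ord1.
Qed.

Lemma euclid_ge0 k (z : 'cV[R]_k) : 0 <= euclid z.
Proof. exact: sqrtr_ge0. Qed.

Lemma euclid_mul m n (C : 'M[R]_(m, n)) (v : 'cV[R]_n) :
  euclid (C *m v) <= Num.sqrt (frob2 C) * euclid v.
Proof. by rewrite !euclidE -sqrtrM ?frob2_ge0// ler_wsqrtr// frob2_mul. Qed.

End psd_matrices.

Section complexification.
Import complex.
Context {R : realType}.
Local Notation toC := (real_complex R).

(** The spectral theorem for the complexification of S, read off on polynomials:
    over the complex numbers S is unitarily diagonalizable, its eigenvalues are
    real because S is symmetric, and nonnegative because each of them has a real
    eigenvector. A polynomial that vanishes on the spectrum annihilates S. *)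
Lemma psd_spectrum k (S : 'M[R]_k.+1) : psdmx S ->
  exists d : seq R, (forall x, x \in d -> 0 <= x) /\
    forall f : {poly R}, (forall x, x \in d -> f.[x] = 0) -> horner_mx S f = 0.
Proof.
move=> [Ssym Spos]; pose SC := map_mx toC S.
have SCreal : SC \is a realmx.
  by apply/mxOverP => i j; rewrite mxE; apply/complex_realP; exists (S i j).
have SCherm : SC \is hermsymmx.
  apply: realsym_hermsym => //.
  by apply/is_hermitianmxP; rewrite expr0 scale1r map_mx_id// /SC map_trmx Ssym.
have /hermitian_normalmx/orthomx_spectralP SCE := SCherm.
have /mxOverP Dreal := hermitian_spectral_diag_real SCherm.
set P := spectralmx SC in SCE; set D := spectral_diag SC in SCE Dreal.
have Pu : P \in unitmx by exact: spectral_unit.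
pose d i := complex.Re (D 0 i).
have DE i : D 0 i = toC (d i) by rewrite RRe_real.
exists [seq d i | i <- enum 'I_k.+1]; split.
  move=> _ /mapP[i _ ->].
  have : eigenvalue SC (D 0 i).
    apply/eigenvalueP; exists (row i P).
      rewrite -row_mul SCE mulmxA mulmxA mulmxV// mul1mx row_mul.
      by rewrite row_diag_mx -scalemxAl -rowE.
    apply/eqP => /(congr1 (fun r => r *m invmx P)).
    rewrite mul0mx -row_mul mulmxV// => /rowP/(_ i); rewrite !mxE eqxx.
    by move/eqP; rewrite oner_eq0.
  rewrite eigenvalue_root_char DE -map_char_poly fmorph_root -eigenvalue_root_char.
  move=> /eigenvalueP[v vS v0].
  have := Spos v^T; rewrite trmxK vS -scalemxAl mxE.
  have vv : 0 < (v *m v^T) 0 0.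
    rewrite -[v in v *m _]trmxK frob2_cV lt_def frob2_ge0 andbT.
    apply: contra v0 => /eqP f0; apply/eqP/trmx_inj.
    by rewrite trmx0; apply: frob2_le0; rewrite f0.
  by rewrite pmulr_lge0.
move=> f fd; apply: (@map_mx_inj _ _ toC).
rewrite map_mx0 map_horner_mx -/SC SCE.
rewrite -[P in _ *m _ *m P]invmxK.
rewrite horner_mx_uconj ?unitmx_inv// horner_mx_diag.
have -> : map_mx (horner (map_poly toC f)) D = 0.
  apply/matrixP => i j; rewrite ord1 !mxE DE horner_map/= fd ?rmorph0//.
  by rewrite map_f// mem_enum.
by rewrite linear0 mulmx0 mul0mx.
Qed.

End complexification.

Section psd_sqrt.
Context {R : realType}.

Lemma psdmx0 (Q : 'M[R]_0) : psdmx Q.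
Proof.
split=> [|u]; first by apply/matrixP => -[].
by rewrite mxE big_ord0.
Qed.

(** A polynomial p with p(x) = x^(1/4) on the spectrum of S gives a symmetric
    matrix W = p(S) with W^4 = S. The square root is W^2, and it is semidefinite
    because it is the Gram matrix of W; this is why fourth roots are
    interpolated rather than square roots. *)
Lemma psd_sqrt_exists k (S : 'M[R]_k) : psdmx S ->
  exists2 Q : 'M[R]_k, psdmx Q & Q *m Q = S.
Proof.
case: k S => [S _|k S Spsd].
  by exists S; [exact: psdmx0|apply/matrixP => -[]].
have [d [d_ge0 dS]] := psd_spectrum Spsd.
have [p pd] := interpolation d (fun x => Num.sqrt (Num.sqrt x)).
pose W := horner_mx S p.
have Wsym : W^T = W by exact/horner_mx_sym/Spsd.1.
exists (W *m W); first split.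
- by rewrite trmx_mul Wsym.
- by move=> u; rewrite -{1}Wsym mulmxA -trmx_mul -mulmxA frob2_cV frob2_ge0.
- have : horner_mx S (p ^+ 4 - 'X) = 0.
    apply: dS => x xd; rewrite !hornerE pd// -[4%N]/(2 * 2)%N exprM.
    by rewrite !sqr_sqrtr ?sqrtr_ge0 ?d_ge0// subrr.
  rewrite rmorphB/= rmorphXn/= horner_mx_X => /eqP; rewrite subr_eq0 => /eqP <-.
  by rewrite -/W !exprS expr0 mulr1 -!mulmxE !mulmxA.
Qed.

Lemma mxsqrtP k (S : 'M[R]_k) : psdmx S ->
  psdmx (mxsqrt S) /\ mxsqrt S *m mxsqrt S = S.
Proof.
move=> /psd_sqrt_exists[Q [Qsym Qpos] QS].
have /getPex[? ? ?] : exists Q : 'M[R]_k, [/\ Q^T = Q,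
    forall u : 'cV[R]_k, 0 <= (u^T *m Q *m u) 0 0 & Q *m Q = S] by exists Q.
by [].
Qed.

Lemma sqrt_unitmx k (Q S : 'M[R]_k) :
  Q *m Q = S -> S \in unitmx -> Q \in unitmx.
Proof. by move=> <-; rewrite unitmx_mul andbb. Qed.

Lemma psdmx_inv k (Q : 'M[R]_k) : psdmx Q -> psdmx (invmx Q).
Proof.
move=> [Qsym Qpos]; have [Qu|Qnu] := boolP (Q \in unitmx); last first.
  by rewrite /invmx (negbTE Qnu).
split=> [|u]; first by rewrite trmx_inv Qsym.
have := Qpos (invmx Q *m u).
by rewrite trmx_mul trmx_inv Qsym -!mulmxA mulKVmx.
Qed.

(** With W = Q^(1/2), u^T Q u is the squared length of W u, and u = W^-1 (W u). *)
Lemma psd_unit_coercive k (Q : 'M[R]_k) : psdmx Q -> Q \in unitmx ->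
  exists2 b : R, 0 < b &
    forall u : 'cV[R]_k, b * frob2 u <= (u^T *m Q *m u) 0 0.
Proof.
move=> Qpsd Qu; have [W [Wsym _] WQ] := psd_sqrt_exists Qpsd.
have Wu := sqrt_unitmx WQ Qu.
have F0 : 0 < frob2 (invmx W) + 1 by rewrite ltr_wpDl ?frob2_ge0.
exists (frob2 (invmx W) + 1)^-1 => [|u]; first by rewrite invr_gt0.
have -> : u^T *m Q *m u = (W *m u)^T *m (W *m u).
  by rewrite trmx_mul Wsym -WQ !mulmxA.
rewrite frob2_cV mulrC ler_pdivrMr//.
rewrite -{1}(mulKmx Wu u); apply: le_trans (frob2_mul _ _) _.
by rewrite mulrC ler_wpM2l ?frob2_ge0// lerDl.
Qed.

Lemma mxtrace_trmx_mul m n (E X : 'M[R]_(m, n)) :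
  \tr (E^T *m X) = \sum_i \sum_j E i j * X i j.
Proof.
rewrite exchange_big; apply: eq_bigr => j _.
by rewrite mxE; apply: eq_bigr => i _; rewrite mxE.
Qed.

Lemma mxtrace_congr_ge k (Q E : 'M[R]_k) (b : R) :
  (forall u : 'cV[R]_k, b * frob2 u <= (u^T *m Q *m u) 0 0) ->
  b * frob2 E <= \tr (E^T *m Q *m E).
Proof.
move=> Qb; have -> : frob2 E = \sum_j frob2 (col j E).
  rewrite /frob2 exchange_big; apply: eq_bigr => j _; apply: eq_bigr => i _.
  by rewrite big_ord1 mxE.
rewrite mulr_sumr; apply: ler_sum => j _; apply: le_trans (Qb _) _.
rewrite tr_col -row_mul [leLHS]mxE [leRHS]mxE; apply: ler_sum => i _.
by rewrite !mxE.
Qed.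

(** With E = A - B one has A^2 - B^2 = A E + E B, so that
    tr (E (A^2 - B^2)) = tr (E A E) + tr (E B E) >= b |E|^2, while
    2 b tr (E (A^2 - B^2)) <= b^2 |E|^2 + |A^2 - B^2|^2. This gives both the
    uniqueness of the positive square root and its continuity. *)
Lemma frob2_sqrt_le k (A B : 'M[R]_k) (b : R) : 0 < b -> psdmx A -> B^T = B ->
  (forall u : 'cV[R]_k, b * frob2 u <= (u^T *m B *m u) 0 0) ->
  b ^+ 2 * frob2 (A - B) <= frob2 (A *m A - B *m B).
Proof.
move=> b0 [Asym Apos] Bsym Bb.
set E := A - B; set X := A *m A - B *m B.
have Esym : E^T = E by rewrite linearB/= Asym Bsym.
have XE : X = A *m E + E *m B.
  by rewrite /X /E mulmxBr mulmxBl addrA subrK.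
have lower : b * frob2 E <= \tr (E^T *m X).
  have AE : 0 <= \tr (E *m A *m E).
    rewrite -[leLHS](mul0r (frob2 E)) -{2}Esym; apply: mxtrace_congr_ge => u.
    by rewrite mul0r Apos.
  have BE : b * frob2 E <= \tr (E *m B *m E).
    by rewrite -{2}Esym; exact: mxtrace_congr_ge.
  have -> : \tr (E^T *m X) = \tr (E *m A *m E) + \tr (E *m B *m E).
    by rewrite XE Esym mulmxDr mxtraceD mulmxA; congr (_ + _); exact: mxtrace_mulC.
  by lra.
have upper : 2 * b * \tr (E^T *m X) <= b ^+ 2 * frob2 E + frob2 X.
  rewrite mxtrace_trmx_mul !mulr_sumr -big_split/=; apply: ler_sum => i _.
  rewrite !mulr_sumr -big_split/=; apply: ler_sum => j _.
  by have := sqr_ge0 (b * E i j - X i j); lra.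
have : 2 * b * (b * frob2 E) <= 2 * b * \tr (E^T *m X) by rewrite ler_pM2l ?mulr_gt0.
by lra.
Qed.

End psd_sqrt.

(** * Limits of matrices and of their square roots *)

Section matrix_limits.
Context (R : realType).

Lemma mx_cvg (T : Type) (F : set_system T) m n
    (f : T -> 'M[R]_(m, n)) (M : 'M[R]_(m, n)) :
  Filter F -> (forall i j, f t i j @[t --> F] --> M i j) -> f t @[t --> F] --> M.
Proof.
move=> FF fM A [P PM PA].
have : \forall t \near F, forall i j, P i j (f t i j).
  by apply: filter_forall => i; apply: filter_forall => j; exact: fM (PM i j).
by apply: filterS => t Pt; exact: PA.
Qed.

Lemma mx_cvg_entry (T : Type) (F : set_system T) m n
    (f : T -> 'M[R]_(m, n)) (M : 'M[R]_(m, n)) :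
  Filter F -> f t @[t --> F] --> M -> forall i j, f t i j @[t --> F] --> M i j.
Proof.
move=> FF fM i j.
exact: (cvg_comp _ (fun A : 'M[R]_(m, n) => A i j) fM
  (@coord_continuous _ _ _ i j M)).
Qed.

Lemma cvg_mulmx (T : Type) (F : set_system T) m n p
    (f : T -> 'M[R]_(m, n)) (g : T -> 'M[R]_(n, p))
    (M : 'M[R]_(m, n)) (N : 'M[R]_(n, p)) :
  Filter F -> f t @[t --> F] --> M -> g t @[t --> F] --> N ->
  f t *m g t @[t --> F] --> M *m N.
Proof.
move=> FF fM gN; apply: mx_cvg => i j; rewrite !mxE.
under eq_cvg do rewrite mxE.
apply: cvg_big => [|l _]; first exact: (@add_continuous R).
by apply: cvgM; exact: mx_cvg_entry.
Qed.

Lemma cvg_frob2 (T : Type) (F : set_system T) m n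
    (f : T -> 'M[R]_(m, n)) (M : 'M[R]_(m, n)) :
  Filter F -> f t @[t --> F] --> M -> frob2 (f t) @[t --> F] --> frob2 M.
Proof.
move=> FF fM; apply: cvg_big => [|i _]; first exact: (@add_continuous R).
apply: cvg_big => [|j _]; first exact: (@add_continuous R).
by apply: cvgM; exact: mx_cvg_entry.
Qed.

Lemma mulmx_continuous m n p (Q : 'M[R]_(m, n)) :
  continuous (mulmx Q : 'M[R]_(n, p) -> 'M[R]_(m, p)).
Proof.
by move=> z; exact: (cvg_mulmx (nbhs_filter z) (@cvg_cst _ Q _ (nbhs z) _) cvg_id).
Qed.

Lemma euclid_continuous k : continuous (@euclid R k).
Proof.
move=> z; rewrite (_ : @euclid R k = Num.sqrt \o @frob2 R k 1); last first.
  by apply/funext => w; exact: euclidE.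
have z2 : frob2 w @[w --> z] --> frob2 z.
  exact: (cvg_frob2 (nbhs_filter z) cvg_id).
exact: (cvg_comp _ Num.sqrt z2 (@sqrt_continuous R _)).
Qed.

Lemma entry_le_euclid k (z : 'cV[R]_k) i : `|z i 0| <= euclid z.
Proof. by rewrite euclidE -sqrtr_sqr ler_wsqrtr// frob2_entry. Qed.

(** The ball is closed in a cube, a product of segments. *)
Lemma euclid_ball_compact k (r : R) :
  compact [set z : 'cV[R]_k | euclid z <= r].
Proof.
pose cube := [set v : 'rV[R]_k | forall i, `[- r, r]%classic (v ord0 i)].
have cube_compact : compact (trmx @` cube).
  apply: continuous_compact; last first.
    apply: (@rV_compact R k (fun=> `[- r, r]%classic)) => i.
    exact: segment_compact.
  apply: continuous_subspaceT => v; apply: (mx_cvg (nbhs_filter v)) => i j.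
  rewrite mxE; under eq_cvg do rewrite mxE.
  exact: (@coord_continuous _ _ _ j i v).
apply: (subclosed_compact _ cube_compact) => [|z zr].
  rewrite (_ : mkset _ = @euclid R k @^-1` [set x | x <= r])//.
  by apply: closed_comp => [z _|]; [exact: euclid_continuous|exact: closed_le].
exists z^T; last exact: trmxK.
move=> i; rewrite /= mxE in_itv/= -ler_norml.
exact: le_trans (entry_le_euclid z i) zr.
Qed.

End matrix_limits.

Section sqrt_limit.
Context (R : realType) (k : nat).

Lemma inv_mxsqrt_inv (S : 'M[R]_k) (A := mxsqrt (invmx S)) :
  psdmx S -> S \in unitmx ->
  [/\ A \in unitmx, psdmx (invmx A) & invmx A *m invmx A = S].
Proof.
move=> Spsd Su; have [Apsd AA] := mxsqrtP (psdmx_inv Spsd).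
have Au : A \in unitmx by apply: sqrt_unitmx AA _; rewrite unitmx_inv.
split=> //; first exact: psdmx_inv.
rewrite -[RHS]invmxK -AA; apply: (can_inj (mulKmx Au)).
rewrite mulKVmx//; apply: (can_inj (mulKmx Au)).
by rewrite mulmxV// mulmxA mulmxV// unitmx_mul Au.
Qed.

Lemma cvg_det (T : Type) (F : set_system T) (f : T -> 'M[R]_k) (M : 'M[R]_k) :
  Filter F -> f t @[t --> F] --> M -> \det (f t) @[t --> F] --> \det M.
Proof.
move=> FF fM; apply: cvg_big => [|s _]; first exact: (@add_continuous R).
apply: cvgM; first exact: cvg_cst.
apply: cvg_big => [|i _]; first exact: mul_continuous.
exact: mx_cvg_entry.
Qed.

Context (M : nat -> 'M[R]_k) (L : 'M[R]_k).
Hypothesis M_psd : forall N, psdmx (M N).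
Hypothesis L_psd : psdmx L.
Hypothesis L_unit : L \in unitmx.
Hypothesis ML : M N @[N --> \oo] --> L.

Lemma near_unitmx : \forall N \near \oo, M N \in unitmx.
Proof.
have L0 : \det L != 0 by rewrite -unitfE -unitmxE.
apply: filterS (cvgr_neq0 _ (cvg_det _ ML) L0) => N MN.
by rewrite unitmxE unitfE.
Qed.

(** The inverse of (M_N^-1)^(1/2) is a semidefinite square root of M_N, hence
    is compared to L^(1/2) by [frob2_sqrt_le]. *)
Lemma inv_mxsqrt_cvg :
  invmx (mxsqrt (invmx (M N))) @[N --> \oo] --> mxsqrt L.
Proof.
have [[Bsym Bpsd] BB] := mxsqrtP L_psd; set B := mxsqrt L in Bsym Bpsd BB *.
have Bu : B \in unitmx by exact: sqrt_unitmx BB L_unit.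
have [b b0 Bb] := psd_unit_coercive (conj Bsym Bpsd) Bu.
have err : frob2 (M N - L) @[N --> \oo] --> (0 : R).
  have -> : 0 = frob2 (L - L).
    by rewrite subrr frob20.
  by apply: cvg_frob2; apply: cvgB; [exact: ML|exact: cvg_cst].
apply: mx_cvg => i j; apply/cvgrPdist_le => e e0.
have be0 : 0 < b ^+ 2 * e ^+ 2 by rewrite mulr_gt0// exprn_gt0.
near=> N.
have Mu : M N \in unitmx by near: N; exact: near_unitmx.
have [_ Qpsd QQ] := inv_mxsqrt_inv (M_psd N) Mu.
have := frob2_sqrt_le b0 Qpsd Bsym Bb; rewrite QQ BB => QB.
have small : frob2 (M N - L) <= b ^+ 2 * e ^+ 2.
  by near: N; exact: (cvgr_le _ err).
rewrite distrC -ler_sqr ?nnegrE ?(ltW e0)// real_normK ?num_real//.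
have := frob2_entry (invmx (mxsqrt (invmx (M N))) - B) i j; rewrite !mxE.
move=> /le_trans; apply; rewrite -(ler_pM2l (exprn_gt0 2 b0)).
exact: le_trans small.
Unshelve. all: by end_near. Qed.

End sqrt_limit.

(** * Symmetric forms and orthogonal projections *)

Section forms.
Context (R : realType) (W : lmodType R) (f : W -> W -> R).
Hypothesis f_lin : forall a x y z, f (a *: x + y) z = a * f x z + f y z.
Hypothesis f_sym : forall x y, f x y = f y x.

Lemma form0 z : f 0 z = 0.
Proof. by have := f_lin (-1) 0 0 z; rewrite scaler0 add0r mulN1r addNr. Qed.

Lemma formD x y z : f (x + y) z = f x z + f y z.
Proof. by rewrite -[x in LHS]scale1r f_lin mul1r. Qed.

Lemma formB x y z : f (x - y) z = f x z - f y z.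
Proof. by rewrite addrC -scaleN1r f_lin mulN1r addrC. Qed.

Lemma form_pythagoras x y : f y x = 0 -> f (x + y) (x + y) = f x x + f y y.
Proof.
move=> yx; rewrite formD f_sym formD yx addr0 [f y _]f_sym formD.
by rewrite [f x y]f_sym yx add0r.
Qed.

Lemma form_sum n (c : 'I_n -> R) (x : 'I_n -> W) z :
  f (\sum_i c i *: x i) z = \sum_i c i * f (x i) z.
Proof.
elim/big_ind2: _ => [|a b a' b' <- <-|i _]; first exact: form0.
  by rewrite -[b in b + b']scale1r f_lin mul1r.
by rewrite -[c i *: x i]addr0 f_lin form0 addr0.
Qed.

Lemma gram_quad n (x : 'I_n -> W) (u : 'cV[R]_n) :
  (u^T *m (\matrix_(i, j) f (x i) (x j)) *m u) 0 0 =
  f (\sum_i u i 0 *: x i) (\sum_i u i 0 *: x i).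
Proof.
rewrite form_sum -mulmxA mxE; apply: eq_bigr => i _; rewrite !mxE; congr (_ * _).
by rewrite f_sym form_sum; apply: eq_bigr => j _; rewrite mxE f_sym mulrC.
Qed.

Lemma gram_psd n (x : 'I_n -> W) : (forall y, 0 <= f y y) ->
  psdmx (\matrix_(i, j) f (x i) (x j)).
Proof.
move=> f0; split=> [|u]; last by rewrite gram_quad.
by apply/matrixP => i j; rewrite !mxE f_sym.
Qed.

End forms.

Section dot_product.
Context (R : realType) (W : lmodType R) (dotW : {dot W for idfun}).

Lemma dot_lin a x y z : dotW (a *: x + y) z = a * dotW x z + dotW y z.
Proof. by rewrite linearPl. Qed.

Lemma dot_sym x y : dotW x y = dotW y x.
Proof. by rewrite hermC expr0 mul1r. Qed.

End dot_product.

Section hilbert_space.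
Context (R : realType) (H : completeNormedModType R) (dotH : {dot H for idfun}).
Hypothesis dotH_norm : forall h, dotH h h = `|h| ^+ 2.

Lemma dot_eq0 x : (forall y, dotH x y = 0) -> x = 0.
Proof. by move=> /(_ x)/eqP; rewrite dotH_norm sqrf_eq0 normr_eq0 => /eqP. Qed.

Section projection.
Context (e : nat -> H).
Hypothesis e_orth : forall i j, dotH (e i) (e j) = (i == j)%:R.

Lemma PE_dot D h (i : 'I_D) : dotH (PE dotH e D h) (e i) = dotH h (e i).
Proof.
rewrite /PE (form_sum (dot_lin dotH)) (bigD1 i)//= e_orth eqxx mulr1 big1 ?addr0//.
by move=> j ji; rewrite e_orth (inj_eq val_inj) (negbTE ji) mulr0.
Qed.

(** h - P h is orthogonal to E_D, which contains E_D0: Pythagoras for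
    h - g = (h - P h) + (P h - g). *)
Lemma PE_best D0 D h g : (D0 <= D)%N -> ED e D0 g ->
  `|h - PE dotH e D h| <= `|h - g|.
Proof.
move=> D0D [c ->]; set g' := \sum_i _; set p := PE _ _ _ _.
have orth (x : H) D1 (a : 'I_D1 -> R) : (D1 <= D)%N ->
    x = \sum_i a i *: e i -> dotH x (h - p) = 0.
  move=> D1D ->; rewrite (form_sum (dot_lin dotH)) big1// => i _.
  rewrite dot_sym (formB (dot_lin dotH)).
  by rewrite (PE_dot h (Ordinal (leq_trans (ltn_ord i) D1D))) subrr mulr0.
have p_orth : dotH p (h - p) = 0 by exact: (orth p D).
have g_orth : dotH g' (h - p) = 0 by exact: (orth g' D0 c).
rewrite -ler_sqr ?nnegrE// -!dotH_norm.
have -> : h - g' = (h - p) + (p - g') by rewrite addrA subrK.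
have pg : dotH (p - g') (h - p) = 0.
  by rewrite (formB (dot_lin dotH)) p_orth g_orth subr0.
rewrite (form_pythagoras (dot_lin dotH) (dot_sym dotH) pg).
by rewrite lerDl dotH_norm sqr_ge0.
Qed.

Lemma PE_cvg h : closure (\bigcup_D ED e D) = setT ->
  forall eps : R, 0 < eps -> exists D0, forall D, (D0 <= D)%N ->
    `|h - PE dotH e D h| < eps.
Proof.
move=> dense eps eps0.
have : closure (\bigcup_D ED e D) h by rewrite dense.
move=> /(_ _ (nbhsx_ballx h eps eps0))[g [[D0 _ gD0] hg]].
exists D0 => D D0D; apply: le_lt_trans (PE_best h D0D gD0) _.
by move: hg; rewrite -ball_normE.
Qed.

End projection.

(** * Galerkin approximation of the information *)

Section galerkin.
Context (e : nat -> H) (I : H -> H).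
Hypothesis e_orth : forall i j, dotH (e i) (e j) = (i == j)%:R.
Hypothesis I_sym : forall h g, dotH (I h) g = dotH (I g) h.
Hypothesis I_ge0 : forall h, 0 <= dotH (I h) h.

Let B h g := dotH (I h) g.

Let B_lin a x y z : B (a *: x + y) z = a * B x z + B y z.
Proof. by rewrite /B I_sym linearPr/= [dotH _ x]I_sym [dotH _ y]I_sym. Qed.

Let B_subr x y z : B x (y - z) = B x y - B x z.
Proof. by rewrite /B linearBr. Qed.

(** I is linear because B is linear in its second argument and symmetric. *)
Lemma info_sum n (c : 'I_n -> R) (x : 'I_n -> H) :
  I (\sum_i c i *: x i) = \sum_i c i *: I (x i).
Proof.
apply/eqP; rewrite -subr_eq0; apply/eqP/dot_eq0 => y.
rewrite (formB (dot_lin dotH)) -[dotH (I _) y]/(B _ y) (form_sum B_lin).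
by rewrite (form_sum (dot_lin dotH)) subrr.
Qed.

Lemma info_kernel h : B h h = 0 -> I h = 0.
Proof.
move=> Bh0; apply: dot_eq0 => g; apply/eqP; rewrite -sqrf_eq0 eq_le sqr_ge0 andbT.
have := psd_form_CauchySchwarz B_lin I_sym I_ge0 h g.
by rewrite Bh0 mul0r.
Qed.

Context (k : nat) (phi psi : 'I_k -> H).
Hypothesis phi_psi : forall i, I (phi i) = psi i.

Let L : 'M[R]_k := \matrix_(i, j) dotH (phi i) (psi j).

Let LE : L = \matrix_(i, j) B (phi i) (phi j).
Proof.
by apply/matrixP => i j; rewrite !mxE -phi_psi dot_sym /B I_sym.
Qed.

Lemma info_gram_psd : psdmx L.
Proof. by rewrite LE; exact: (gram_psd B_lin I_sym). Qed.

(** A kernel vector v of L gives h, the combination of the phi_i with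
    coefficients v, such that B(h, h) = v^T L v = 0, hence I h = 0; but I h is
    the combination of the psi_i with the same coefficients. *)
Lemma info_gram_unit : lin_indep psi -> L \in unitmx.
Proof.
move=> indep; rewrite -unitmx_tr -row_free_unit -kermx_eq0.
apply/eqP/row_matrixP => i; rewrite row0.
set v := row i _; have vL : v *m L^T = 0.
  by apply/eqP; rewrite -sub_kermx row_sub.
have Lv : L *m v^T = 0 by rewrite -[L]trmxK -trmx_mul vL trmx0.
have : B (\sum_j v^T j 0 *: phi j) (\sum_j v^T j 0 *: phi j) = 0.
  by rewrite -(gram_quad B_lin I_sym) -LE -mulmxA Lv mulmx0 mxE.
move=> /info_kernel; rewrite info_sum => Ipsi.
have /indep v0 : \sum_j v^T j 0 *: psi j = 0.
  by rewrite -[RHS]Ipsi; apply: eq_bigr => j _; rewrite phi_psi.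
by apply/rowP => j; have := v0 j; rewrite !mxE.
Qed.

Context (D : nat).
Hypothesis infoD_inj : {in ED e D &, injective (infoD dotH e I D)}.

Let A := infoDmx dotH e I D.
Let J := Jmx dotH e psi D.
Let M := J *m invmx A *m J^T.

Let AE i j : A i j = B (e i) (e j).
Proof. by rewrite mxE PE_dot. Qed.

(** A row v with v [I_D] = 0 holds the coordinates of an element of E_D whose
    image under I is orthogonal to E_D, that is, of a zero of I_D. *)
Lemma infoDmx_unit : A \in unitmx.
Proof.
rewrite -row_free_unit -kermx_eq0; apply/eqP/row_matrixP => i; rewrite row0.
set v := row i _; have vA : v *m A = 0.
  by apply/eqP; rewrite -sub_kermx row_sub.
have ED0 : ED e D 0 by exists (fun=> 0); rewrite big1// => j _; rewrite scale0r.
pose h := \sum_(j < D) v 0 j *: e j.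
have EDh : ED e D h by exists (v 0).
have infoE (g : H) : (forall j : 'I_D, B g (e j) = 0) -> infoD dotH e I D g = 0.
  by move=> gj; rewrite /infoD /PE big1// => j _; rewrite [dotH _ _]gj scale0r.
have h0 : h = 0.
  apply: infoD_inj; rewrite ?inE// !infoE// => j; first by rewrite (form0 B_lin).
  have /rowP/(_ j) := vA; rewrite !mxE => <-.
  by rewrite (form_sum B_lin); apply: eq_bigr => l _; rewrite AE.
apply/rowP => j; rewrite [RHS]mxE.
have := form0 (dot_lin dotH) (e j).
rewrite -h0 (form_sum (dot_lin dotH)) (bigD1 j)//=.
rewrite e_orth eqxx mulr1 big1 ?addr0// => l lj.
by rewrite e_orth (inj_eq val_inj) (negbTE lj) mulr0.
Qed.

(** The Galerkin approximation of phi_j in E_D. *)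
Let u j : H := \sum_l (invmx A *m J^T) l j *: e l.

(** The defining property of u_j: the coordinates of u_j solve the linear system
    with matrix [I_D] and right-hand side <psi_j, e_i> = B(phi_j, e_i). *)
Let u_orth j (c : 'I_D -> R) (g : H) :
  g = \sum_i c i *: e i -> B (phi j - u j) g = 0.
Proof.
move=> ->; rewrite /B I_sym -/(B _ _) (form_sum B_lin) big1// => i _.
rewrite /B I_sym -/(B _ _) (formB B_lin) {2}/B I_sym -/(B _ _).
have -> : B (e i) (u j) = (A *m (invmx A *m J^T)) i j.
  rewrite /B dot_sym (form_sum (dot_lin dotH)) mxE; apply: eq_bigr => l _.
  by rewrite AE mulrC dot_sym.
by rewrite mulKVmx ?infoDmx_unit// !mxE -phi_psi subrr mulr0.
Qed.

Let phi_u i j : B (phi i) (u j) = B (u i) (u j).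
Proof.
by apply/eqP; rewrite -subr_eq0 -(formB B_lin) (u_orth i (g := u j) erefl).
Qed.

Let ME : M = \matrix_(i, j) B (u i) (u j).
Proof.
apply/matrixP => i j; rewrite [RHS]mxE -phi_u.
rewrite /M -mulmxA mxE /B phi_psi dot_sym (form_sum (dot_lin dotH)).
by apply: eq_bigr => l _; rewrite [J i l]mxE mulrC dot_sym.
Qed.

Lemma galerkin_psd : psdmx M.
Proof. by rewrite ME; exact: (gram_psd B_lin I_sym). Qed.

Let p j := PE dotH e D (phi j).

Let u_residual i j : B (phi j - u j) (phi i - p i) = B (phi j - u j) (phi i).
Proof. by rewrite B_subr (u_orth j (g := p i) erefl) subr0. Qed.

(** The difference L_ij - B(u_i, u_j) equals B(phi_j - u_j, phi_i - P phi_i), and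
    the energy of phi_j - u_j is at most that of phi_j - P phi_j. *)
Lemma galerkin_error i j : (L i j - M i j) ^+ 2 <=
  dotH (I (phi i - p i)) (phi i - p i) * dotH (I (phi j - p j)) (phi j - p j).
Proof.
have -> : L i j - M i j = B (phi j - u j) (phi i - p i).
  rewrite u_residual LE ME !mxE (formB B_lin) [B (phi j) _]I_sym; congr (_ - _).
  by rewrite -phi_u /B I_sym.
have CS := psd_form_CauchySchwarz B_lin I_sym I_ge0.
have rE : B (phi j - u j) (phi j - u j) = B (phi j - u j) (phi j - p j).
  rewrite u_residual [X in X = _]B_subr.
  by rewrite (u_orth j (g := u j) erefl) subr0.
have r_le : B (phi j - u j) (phi j - u j) <= B (phi j - p j) (phi j - p j).
  have [->|r0] := eqVneq (B (phi j - u j) (phi j - u j)) 0; first exact: I_ge0.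
  have := CS (phi j - u j) (phi j - p j); rewrite -rE expr2.
  by rewrite ler_pM2l// lt_def r0 I_ge0.
apply: le_trans (CS _ _) _.
by rewrite mulrC ler_wpM2l ?I_ge0.
Qed.

End galerkin.

End hilbert_space.

Section galerkin_limit.
Context (R : realType) (H : completeNormedModType R) (dotH : {dot H for idfun}).
Hypothesis dotH_norm : forall h, dotH h h = `|h| ^+ 2.
Context (e : nat -> H) (I : H -> H).
Hypothesis e_basis : orthonormal_basis dotH e.
Hypothesis I_sym : forall h g, dotH (I h) g = dotH (I g) h.
Hypothesis I_ge0 : forall h, 0 <= dotH (I h) h.
Context (K : R).
Hypothesis I_bounded : forall h, dotH (I h) h <= K ^+ 2 * `|h| ^+ 2.
Hypothesis infoD_inj : forall D, {in ED e D &, injective (infoD dotH e I D)}.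
Context (k : nat) (phi psi : 'I_k -> H).
Hypothesis phi_psi : forall i, I (phi i) = psi i.
Context (D : nat -> nat).
Hypothesis D_oo : D @ \oo --> \oo.

Let p N i := PE dotH e (D N) (phi i).

Let projection_error i : `|phi i - p N i| @[N --> \oo] --> (0 : R).
Proof.
apply/cvgr0Pnorm_lt => eps eps0.
have [D0 D0P] := PE_cvg dotH_norm e_basis.1 (phi i) e_basis.2 eps0.
have D_large : \forall N \near \oo, (D0 <= D N)%N.
  by have := D_oo (nbhs_infty_ge D0).
by apply: filterS D_large => N D0N; rewrite normr_id; exact: D0P.
Qed.

Lemma galerkin_cvg :
  invmx (iD dotH e I psi (D N)) @[N --> \oo] -->
  (\matrix_(i, j) dotH (phi i) (psi j) : 'M[R]_k).
Proof.
apply: mx_cvg => i j.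
pose err N := K ^+ 2 * (`|phi i - p N i| * `|phi j - p N j|).
have err0 : err N @[N --> \oo] --> (0 : R).
  rewrite -(mulr0 (K ^+ 2)); apply: cvgM; first exact: cvg_cst.
  by rewrite -[X in _ --> X](mulr0 0); apply: cvgM; exact: projection_error.
apply/cvgrPdist_le => eps eps0; near=> N.
apply: (@le_trans _ _ (err N)); last by near: N; exact: (cvgr_le _ err0).
have err_ge0 : 0 <= err N by rewrite mulr_ge0 ?sqr_ge0// mulr_ge0.
rewrite -ler_sqr ?nnegrE// real_normK ?num_real// /iD invmxK.
have := galerkin_error e_basis.1 I_sym I_ge0 phi_psi (@infoD_inj (D N)) i j.
move=> /le_trans; apply.
have -> : err N ^+ 2 =
    (K ^+ 2 * `|phi i - p N i| ^+ 2) * (K ^+ 2 * `|phi j - p N j| ^+ 2).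
  by rewrite /err; ring.
by apply: ler_pM; rewrite ?I_ge0 ?I_bounded.
Unshelve. all: by end_near. Qed.

End galerkin_limit.

Section information.
Context (R : realType) (dim : nat) (X : set (Rn R dim)).
Context (lam : probability (Rn R dim) R).
Context (V : normedModType R) (dotV : {dot V for idfun}).
Context (H : completeNormedModType R) (dotH : {dot H for idfun}).
Context (T : H -> Rn R dim -> V) (Tadj : (Rn R dim -> V) -> H).
Hypothesis dotV_norm : forall v, dotV v v = `|v| ^+ 2.
Hypothesis T_op : bounded_linear_op X lam T.
Hypothesis Tadj_adj : is_adjoint X lam dotV dotH T Tadj.

Let infoE h g : dotH (information_op T Tadj h) g = dotL2 X lam dotV (T h) (T g).
Proof. by have [T_L2 _ _] := T_op; exact: Tadj_adj. Qed.

Let dotL2_normE f :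
  dotL2 X lam dotV f f = \int[lam]_(x in X) (`|f x| ^+ 2).
Proof. by apply: eq_Rintegral => x _; rewrite dotV_norm. Qed.

Lemma information_sym h g :
  dotH (information_op T Tadj h) g = dotH (information_op T Tadj g) h.
Proof. by rewrite !infoE; apply: eq_Rintegral => x _; exact: dot_sym. Qed.

Lemma information_ge0 h : 0 <= dotH (information_op T Tadj h) h.
Proof.
by rewrite infoE dotL2_normE; apply: Rintegral_ge0 => x _; exact: sqr_ge0.
Qed.

Lemma information_bounded : exists K : R, forall h,
  dotH (information_op T Tadj h) h <= K ^+ 2 * `|h| ^+ 2.
Proof.
have [_ _ [K TK]] := T_op; exists K => h.
have := information_ge0 h; rewrite infoE dotL2_normE => int_ge0.
rewrite -(sqr_sqrtr int_ge0) -exprMn; apply: lerXn2r (TK h).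
  by rewrite nnegrE sqrtr_ge0.
by rewrite nnegrE; apply: le_trans (TK h); exact: sqrtr_ge0.
Qed.

End information.

(** * Integrals against set functions *)

Section set_function_integral.
Import HBSimple HBNNSimple.
Local Open Scope ereal_scope.

(** The integral of a nonnegative function is a supremum over simple functions
    below it; for a function that is not measurable, or for a set function that is
    not a measure, this is a lower integral, which keeps the properties below. *)
Definition lower_integral d (T : measurableType d) (R : realType)
    (m : set T -> \bar R) (f : T -> \bar R) : \bar R :=
  ereal_sup [set sintegral m h |
    h in [set h : {nnsfun T >-> R} | forall x, (h x)%:E <= f x]].

Lemma integral_lowerE d (T : measurableType d) (R : realType)
    (m : set T -> \bar R) (f : T -> \bar R) :
  \int[m]_x f x = lower_integral m f^\+ - lower_integral m f^\-.
Proof. by rewrite /integral patch_setT. Qed.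

Lemma le_lower_integral d (T : measurableType d) (R : realType)
    (m : set T -> \bar R) (f g : T -> \bar R) : (forall x, f x <= g x) ->
  lower_integral m f <= lower_integral m g.
Proof.
move=> fg; apply: le_ereal_sup => _ [h hf <-]; exists h => // x.
exact: le_trans (hf x) (fg x).
Qed.

Lemma le_integral_setfun d (T : measurableType d) (R : realType)
    (m : set T -> \bar R) (f g : T -> R) : (forall x, (f x <= g x)%R) ->
  \int[m]_x (f x)%:E <= \int[m]_x (g x)%:E.
Proof.
move=> fg; rewrite !integral_lowerE; apply: leeB; apply: le_lower_integral => x.
- by rewrite !funeposE ge_max !le_max lexx orbT andbT lee_fin fg.
- by rewrite !funenegE ge_max !le_max lexx orbT andbT leeN2 lee_fin fg.
Qed.

Lemma nnsfun_comp d1 d2 (T1 : measurableType d1) (T2 : measurableType d2)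
  (R : realType) (phi : T1 -> T2) (h : {nnsfun T2 >-> R}) :
  measurable_fun setT phi -> exists g : {nnsfun T1 >-> R}, g =1 h \o phi.
Proof.
move=> mphi.
have mh : measurable_fun setT (h \o phi) by exact: measurableT_comp.
have fh : finite_set (range (h \o phi)).
  by apply: sub_finite_set (fimfunP h) => _ [x _ <-]; exists (phi x).
have nh x : (0 <= (h \o phi) x)%R by exact: fun_ge0.
pose gM := isMeasurableFun.Build _ _ _ _ _ mh.
pose gF := FiniteImage.Build _ _ _ fh.
pose gN := isNonNegFun.Build _ _ _ nh.
pose g : {nnsfun T1 >-> R} := HB.pack (h \o phi) gM gF gN.
by exists g.
Qed.

Section change_of_variables.
Context d1 d2 (T1 : measurableType d1) (T2 : measurableType d2) (R : realType).

Lemma lower_integral_bij (m : set T1 -> \bar R) (phi : T1 -> T2)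
    (psi : T2 -> T1) (f : T2 -> \bar R) :
  measurable_fun setT phi -> measurable_fun setT psi ->
  cancel psi phi -> cancel phi psi ->
  lower_integral (pushforward m phi) f = lower_integral m (f \o phi).
Proof.
move=> mphi mpsi psiK phiK; congr ereal_sup; apply/seteqP; split=> _ [h hf <-].
- have [g gE] := nnsfun_comp h mphi; exists g => [x|].
    by rewrite gE; exact: hf.
  by rewrite (eq_sintegral (h \o phi))//.
- have [g gE] := nnsfun_comp h mpsi; exists g => [x|].
    by rewrite gE; have := hf (psi x); rewrite /= psiK.
  rewrite (eq_sintegral (h \o psi))// /sintegral; apply: eq_fsbigr => x _.
  rewrite /pushforward (_ : phi @^-1` _ = h @^-1` [set x])//.
  by apply/funext => y /=; rewrite phiK.
Qed.

Lemma integral_pushforward_bij (m : set T1 -> \bar R) (phi : T1 -> T2)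
    (psi : T2 -> T1) (f : T2 -> \bar R) :
  measurable_fun setT phi -> measurable_fun setT psi ->
  cancel psi phi -> cancel phi psi ->
  \int[pushforward m phi]_x f x = \int[m]_x f (phi x).
Proof.
move=> mphi mpsi psiK phiK.
rewrite !integral_lowerE !(lower_integral_bij _ _ mphi mpsi psiK phiK).
by rewrite -funepos_comp -funeneg_comp.
Qed.

End change_of_variables.

Section scaling.
Context d (T : measurableType d) (R : realType) (m : set T -> \bar R).
Hypothesis m0 : m set0 = 0.
Hypothesis m_ge0 : forall A, 0 <= m A.


Lemma sintegralZ_setfun (c : R) (h : {nnsfun T >-> R}) : (0 < c)%R ->
  sintegral m (cst c \* h)%R = c%:E * sintegral m h.
Proof.
move=> c0; rewrite !sintegralET ge0_mule_fsumr; last first.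
  move=> x; have [x0|x0] := leP 0%R x; first by rewrite mule_ge0.
  suff -> : h @^-1` [set x] = set0 by rewrite m0 mule0.
  by rewrite preimage_nnfun0.
rewrite (reindex_fsbigT ( *%R c))/=; last first.
  by exists ( *%R c^-1); [apply: mulKf|apply: mulVKf]; rewrite gt_eqF.
apply: eq_fsbigr => x _.
by rewrite preimage_cstM ?gt_eqF// [(_ / c)%R]mulrC mulKf ?gt_eqF// muleA.
Qed.

Lemma le_lower_integralZ (c : R) (f : T -> \bar R) : (0 < c)%R ->
  c%:E * lower_integral m f <= lower_integral m (fun x => c%:E * f x).
Proof.
move=> c0; rewrite -lee_pdivlMl//; apply: ge_ereal_sup => _ [h hf <-].
rewrite lee_pdivlMl// -sintegralZ_setfun//; apply: ereal_sup_ubound.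
exists (scale_nnsfun h (ltW c0)) => // x.
by rewrite /= EFinM lee_pmul2l.
Qed.

Lemma lower_integralZ (c : R) (f : T -> \bar R) : (0 < c)%R ->
  lower_integral m (fun x => c%:E * f x) = c%:E * lower_integral m f.
Proof.
move=> c0; apply/eqP; rewrite eq_le le_lower_integralZ// andbT.
rewrite -lee_pdivrMl//.
apply: le_trans (le_lower_integralZ _ _) _; first by rewrite invr_gt0.
apply: le_lower_integral => x.
by rewrite muleA -EFinM mulVf ?gt_eqF// mul1e.
Qed.

(** The two hypotheses on m make the sums defining the integrals of simple
    functions sums of nonnegative terms. *)
Lemma integralZ_setfun (c : R) (f : T -> R) : (0 < c)%R ->
  \int[m]_x (c * f x)%:E = c%:E * \int[m]_x (f x)%:E.
Proof.
move=> c0; rewrite !integral_lowerE.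
have -> : (fun x => (c * f x)%:E)^\+ = fun x => c%:E * (fun y => (f y)%:E)^\+ x.
  apply/funext => x; rewrite !funeposE EFinM.
  by rewrite maxe_pMr ?mule0// lee_fin ltW.
have -> : (fun x => (c * f x)%:E)^\- = fun x => c%:E * (fun y => (f y)%:E)^\- x.
  apply/funext => x; rewrite !funenegE EFinM -muleN.
  by rewrite maxe_pMr ?mule0// lee_fin ltW.
rewrite !lower_integralZ//.
case: (lower_integral _ _) (lower_integral _ _) => [x| |] [y| |];
  by rewrite /= -?EFinB ?(gt0_muley, gt0_muleNy) ?lte_fin//= -?EFinM -?EFinB ?mulrBr.
Qed.

End scaling.
End set_function_integral.

Section posterior_set_function.
Context (R : realType) (H : completeNormedModType R).
Context (E : set H) (Pi : probability (borel H) R) (l : H -> R).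

Lemma posterior_set0 : posterior E Pi l set0 = 0%E.
Proof. by rewrite /posterior setI0 integral_set0 mul0e. Qed.

Lemma posterior_ge0 A : (0 <= posterior E Pi l A)%E.
Proof.
rewrite mule_ge0 ?lee_fin ?invr_ge0 ?fine_ge0//;
  by apply: integral_ge0 => th _; rewrite lee_fin expR_ge0.
Qed.

End posterior_set_function.

(** * Borel measurability and the standard Gaussian law *)

Section borel_measurability.
Context (R : realType).

Lemma continuous_borel_fun (T : normedModType R) (f : T -> R) :
  continuous f -> measurable_fun [set: borel T] (f : borel T -> measurableTypeR R).
Proof.
move=> /continuousP cf; apply: (measurability _ (RGenOpens.measurableE R)).
move=> _ [_ [a [b ->]] <-]; rewrite setTI; apply: sub_sigma_algebra.
by apply: cf; exact: interval_open.
Qed.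

Lemma continuous_borel_map (T U : normedModType R) (f : T -> U) :
  continuous f -> measurable_fun [set: borel T] (f : borel T -> borel U).
Proof.
move=> /continuousP cf.
apply: (@measurability _ _ (borel T) (borel U) setT f (@open U) erefl).
by move=> _ [A oA <-]; rewrite setTI; apply: sub_sigma_algebra; exact: cf.
Qed.

(** The product sigma-algebra contains the open sets of R^k: an open set is the
    union of the countably many rational cubes that it contains. *)
Lemma measurable_col k :
  measurable_fun [set: Rn R k]
    (fun t => (\col_i (tnth t i : R)) : borel 'cV[R]_k).
Proof.
set phi := fun t : Rn R k => _.
apply: (@measurability _ _ _ (borel 'cV[R]_k) setT phi (@open 'cV[R]_k) erefl).
move=> _ [U oU <-]; rewrite setTI.
pose box (p : {ffun 'I_k -> rat} * nat) : set (Rn R k) :=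
  [set t | forall i, `|(tnth t i : R) - ratr (p.1 i)| < p.2.+1%:R^-1].
pose F p := [set t | box p t /\ box p `<=` phi @^-1` U].
have mbox p : measurable (box p).
  have -> : box p = \bigcap_(i in [set: 'I_k])
      ((fun t : Rn R k => tnth t i) @^-1` ball (ratr (p.1 i) : R) p.2.+1%:R^-1).
    apply/seteqP; split => t /=.
      by move=> pt i _; rewrite -ball_normE /= distrC; exact: pt.
    by move=> pt i; have := pt i I; rewrite /= -ball_normE /= distrC.
  apply: fin_bigcap_measurable => // i _.
  rewrite -[X in measurable X]setTI; apply: measurable_tnth => //.
  exact: measurable_ball.
have -> : phi @^-1` U = \bigcup_p F p.
  apply/seteqP; split=> [t Ut|t [p _ [pt]]]; last exact.
  have := oU; rewrite openE => /(_ _ Ut)/nbhs_ballP[e /= e0 eU].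
  have [n ne] : exists n, n.+1%:R^-1 < e / 2.
    by have [n] := ltr_add_invr (divr_gt0 e0 (@ltr0n R 2)); rewrite add0r; exists n.
  have near_rat i : exists q : rat, `|(tnth t i : R) - ratr q| < n.+1%:R^-1.
    have n0 : 0 < n.+1%:R^-1 :> R by rewrite invr_gt0.
    have : (tnth t i : R) - n.+1%:R^-1 < tnth t i + n.+1%:R^-1.
      by rewrite ltrBlDr -addrA ltrDl addr_gt0.
    move=> /rat_in_itvoo[q]; rewrite in_itv/= => /andP[q1 q2]; exists q.
    by rewrite ltr_distlC q1 q2.
  have [q qt] := choice near_rat.
  exists ([ffun i => q i], n) => //; split=> [i|s sq]; first by rewrite ffunE.
  apply: eU; split => // i j; rewrite !mxE -ball_normE /=.
  have := sq i; rewrite ffunE /= => sqi.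
  rewrite (splitr e); apply: le_lt_trans (ler_distD (ratr (q i)) _ _) _.
  apply: ltrD; first exact: lt_trans (qt i) ne.
  by rewrite distrC; exact: lt_trans sqi ne.
apply: countable_bigcupT_measurable => [|p]; first exact: countableP.
have [h|h] := pselect (box p `<=` phi @^-1` U).
  by rewrite (_ : F p = box p)//; apply/seteqP; split=> // t [].
by rewrite (_ : F p = set0)//; apply/seteqP; split=> // t [].
Qed.

End borel_measurability.

Section std_normal.
Context (R : realType).

Lemma std_normal_setT n : @std_normal R n setT = 1%E.
Proof.
elim: n => [|n IH]; first by rewrite /std_normal /= diracT.
rewrite /std_normal /= /mcons /pushforward preimage_setT -setXTT.
rewrite product_measure1E// [X in (_ * X)%E]IH mule1.
exact: probability_setT.
Qed.

HB.instance Definition _ n := Measure.on (@std_normal R n).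
HB.instance Definition _ n :=
  Measure_isProbability.Build _ _ _ (@std_normal R n) (std_normal_setT n).

Lemma mxsqrt1 k : mxsqrt (1%:M : 'M[R]_k) = 1%:M.
Proof.
have psd1 : psdmx (1%:M : 'M[R]_k).
  by split=> [|u]; rewrite ?trmx1// mulmx1 frob2_cV frob2_ge0.
have [Qpsd QQ] := mxsqrtP psd1.
have : 1 ^+ 2 * frob2 (mxsqrt (1%:M : 'M[R]_k) - 1%:M) <= 0.
  apply: le_trans (frob2_sqrt_le _ Qpsd _ _) _ => //; first exact: trmx1.
    by move=> u; rewrite mulmx1 frob2_cV mul1r.
  by rewrite QQ mulmx1 subrr frob20.
by rewrite expr1n mul1r => /frob2_le0/eqP; rewrite subr_eq0 => /eqP.
Qed.

(** All the laws N(0, S) are linear images of the same probability N(0, I_k). *)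
Lemma gauss1_probability k : exists gamma : probability (borel 'cV[R]_k) R,
  gauss (1%:M : 'M[R]_k) = gamma /\
  forall S : 'M[R]_k,
    gauss S = pushforward gamma (fun z => mxsqrt S *m z : borel 'cV[R]_k).
Proof.
pose col (t : Rn R k) : borel 'cV[R]_k := \col_i (tnth t i : R).
pose colM := isMeasurableFun.Build _ _ _ _ col (@measurable_col R k).
pose mcol : {mfun Rn R k >-> borel 'cV[R]_k} := HB.pack col colM.
have gaussE (S : 'M[R]_k) : gauss S =
    pushforward (distribution (@std_normal R k) mcol)
      (fun z => mxsqrt S *m z : borel 'cV[R]_k) by [].
exists (distribution (@std_normal R k) mcol); split=> //.
rewrite gaussE mxsqrt1; apply/funext => A; rewrite /pushforward.
by congr (distribution _ _ _); apply/funext => z /=; rewrite mul1mx.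
Qed.

End std_normal.

Section tail.
Context (R : realType) (k : nat) (gamma : probability (borel 'cV[R]_k) R).
Local Notation mean f := (\int[gamma]_z f z)%R.

Lemma bounded_continuous_integrable (f : 'cV[R]_k -> R) (M : R) :
  continuous f -> (forall z, `|f z| <= M) -> gamma.-integrable setT (EFin \o f).
Proof.
move=> cf fM; apply: measurable_bounded_integrable => //.
- by rewrite (le_lt_trans (probability_le1 _ _))// ltry.
- exact: continuous_borel_fun.
- exists M; split=> [|x Mx z _]; first exact: num_real.
  exact: le_trans (fM z) (ltW Mx).
Qed.

Lemma integral_mean (f : 'cV[R]_k -> R) (M : R) :
  continuous f -> (forall z, `|f z| <= M) ->
  (\int[gamma]_z (f z)%:E)%E = (mean f)%:E.
Proof.
move=> cf fM; rewrite /Rintegral fineK//.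
by apply: integrable_fin_num => //; exact: bounded_continuous_integrable fM.
Qed.

(** A continuous substitute for the indicator of the complement of a ball: being
    continuous and bounded it is itself a test function for weak convergence,
    and it dominates that indicator. *)
Definition tail n (z : 'cV[R]_k) : R := Num.min 1 (euclid z / n.+1%:R).

Lemma tail_ge0 n z : 0 <= tail n z.
Proof. by rewrite le_min ler01 divr_ge0// euclid_ge0. Qed.

Lemma tail_le1 n z : tail n z <= 1.
Proof. by rewrite ge_min lexx. Qed.

Lemma tail_norm n z : `|tail n z| <= 1.
Proof. by rewrite ger0_norm ?tail_ge0// tail_le1. Qed.

Lemma tail_out n z : n.+1%:R <= euclid z -> tail n z = 1.
Proof. by move=> nz; apply/min_idPl; rewrite ler_pdivlMr// mul1r. Qed.

Lemma tail_continuous n : continuous (tail n).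
Proof.
move=> z; apply: (@continuous_min _ _ (cst 1) (fun z => euclid z / n.+1%:R)).
  exact: (@cvg_cst _ (1 : R) _ (nbhs z) _).
apply: cvgM; [exact: (nbhs_filter z)|exact: (@euclid_continuous R k z)|].
exact: (@cvg_cst _ _ _ (nbhs z) _).
Qed.

Lemma tail_mean_small (eta : R) : 0 < eta -> exists n, mean (tail n) < eta.
Proof.
move=> eta0.
have : (\int[gamma]_z (tail n z)%:E)%E @[n --> \oo] --> (\int[gamma]_z (cst 0 z))%E.
  apply: (@dominated_cvg _ _ _ gamma setT measurableT
    (fun n z => (tail n z)%:E) (cst 0%E) (cst 1%E)) => //.
  - move=> n; apply/measurable_EFinP; apply: (continuous_borel_fun (f := tail n)).
    exact: tail_continuous.
  - move=> z _; apply: cvg_EFin; first by apply: nearW.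
    rewrite (_ : (_ \o _) = fun n => tail n z)//.
    apply: (@squeeze_cvgr _ _ _ _ (cst 0) (fun n => euclid z * n.+1%:R^-1)).
    + by apply: nearW => n; rewrite tail_ge0 /tail ge_min lexx orbT.
    + exact: cvg_cst.
    + rewrite -[X in _ --> X](mulr0 (euclid z)); apply: cvgM; first exact: cvg_cst.
      exact: cvg_harmonic.
  - apply: (bounded_continuous_integrable (f := cst 1) (M := 1)) => [|z].
      exact: cst_continuous.
    by rewrite normr1.
  - by move=> n z _; rewrite lee_fin tail_norm.
rewrite integral_cst// mul0e => /fine_cvgP[_] /cvgr0Pnorm_lt/(_ _ eta0)[n _ nP].
exists n; have := nP n (leqnn n); rewrite /=.
exact: le_lt_trans (ler_norm _).
Qed.

End tail.

(** * Weak convergence of linear images *)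

Section continuous_functions.
Context (R : realType) (T : topologicalType).
Implicit Types f g : T -> R.

Lemma continuous_addf f g :
  continuous f -> continuous g -> continuous (fun z => f z + g z).
Proof. by move=> cf cg z; apply: cvgD; [exact: cf|exact: cg]. Qed.

Lemma continuous_subf f g :
  continuous f -> continuous g -> continuous (fun z => f z - g z).
Proof. by move=> cf cg z; apply: cvgB; [exact: cf|exact: cg]. Qed.

Lemma continuous_scalef (a : R) f :
  continuous f -> continuous (fun z => a * f z).
Proof. by move=> cf z; apply: cvgM; [exact: cvg_cst|exact: cf]. Qed.

End continuous_functions.

Lemma ereal_cvg_approx (R : realType) (x : nat -> \bar R) (F : R) :
  (forall eta, 0 < eta ->
    \forall N \near \oo, ((F - eta)%:E <= x N <= (F + eta)%:E)%E) ->
  x N @[N --> \oo] --> F%:E.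
Proof.
move=> xF; apply/fine_cvgP; split.
  apply: filterS (xF 1 ltr01) => N /andP[lo hi].
  by rewrite fin_numElt (lt_le_trans _ lo) ?ltNyr// (le_lt_trans hi) ?ltry.
apply/cvgrPdist_le => eta eta0; apply: filterS (xF _ eta0) => N /=.
case: (x N) => [r| |]//=; last by rewrite leye_eq andbF.
rewrite !lee_fin ler_distlC => /andP[lo hi].
by rewrite lo hi.
Qed.

Section linear_images.
Context (R : realType) (k : nat) (gamma : probability (borel 'cV[R]_k) R).
Local Notation mean f := (\int[gamma]_z f z)%R.
Local Notation linmap Q := (fun z => Q *m z : borel 'cV[R]_k).

(** The form in which two test functions are compared: uniformly close on a
    ball, and merely bounded outside. *)
Lemma le_mean_tail (f g : 'cV[R]_k -> R) (M delta C : R) n :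
  continuous f -> continuous g ->
  (forall z, `|f z| <= M) -> (forall z, `|g z| <= M) ->
  (forall z, `|f z - g z| <= delta + C * tail n z) ->
  `|mean f - mean g| <= delta + C * mean (@tail R k n).
Proof.
move=> cf cg fM gM fg.
have tail_int := bounded_continuous_integrable gamma
  (@tail_continuous R k n) (@tail_norm R k n).
have f_int := bounded_continuous_integrable gamma cf fM.
have g_int := bounded_continuous_integrable gamma cg gM.
have one_int : gamma.-integrable setT (EFin \o (fun=> delta)).
  apply: (bounded_continuous_integrable gamma (M := `|delta|)) => //.
  exact: cst_continuous.
have fg_int : gamma.-integrable setT (EFin \o (fun z => f z - g z)).
  apply: (bounded_continuous_integrable gamma (M := M + M)) => [|z].
    exact: continuous_subf.
  by apply: le_trans (ler_normB _ _) _; exact: lerD.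
have Ctail_int : gamma.-integrable setT (EFin \o (fun z => C * tail n z)).
  apply: (bounded_continuous_integrable gamma (M := `|C|)) => [|z].
    by apply: continuous_scalef; exact: tail_continuous.
  by rewrite normrM ler_piMr// tail_norm.
rewrite -RintegralB//; apply: le_trans (le_normr_Rintegral _ _) _ => //.
have -> : delta + C * mean (@tail R k n) = \int[gamma]_z (delta + C * tail n z).
  by rewrite RintegralD// RintegralZl// Rintegral_cst//= probability_setT mulr1.
apply: le_Rintegral => //.
  exact: (integrable_norm fg_int).
exact: (integrableD _ one_int Ctail_int).
Qed.

Lemma measurable_linmap (Q : 'M[R]_k) :
  measurable_fun [set: borel 'cV[R]_k] (linmap Q).
Proof. by apply: continuous_borel_map; exact: mulmx_continuous. Qed.

Lemma integral_linear_image (m : set (borel 'cV[R]_k) -> \bar R) (Q : 'M[R]_k)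
    (f : 'cV[R]_k -> \bar R) : Q \in unitmx ->
  (\int[pushforward m (linmap Q)]_z f z = \int[m]_z f (Q *m z))%E.
Proof.
move=> Qu.
have phiK : cancel (linmap Q) (linmap (invmx Q)) by move=> z; rewrite mulKmx.
have psiK : cancel (linmap (invmx Q)) (linmap Q) by move=> z; rewrite mulKVmx.
refine (@integral_pushforward_bij _ _ (borel _) (borel _) R m
  (linmap Q) (linmap (invmx Q)) f _ _ psiK phiK);
  exact: measurable_linmap.
Qed.

Lemma BL1_continuous (f : 'cV[R]_k -> R) : BL1 f -> continuous f.
Proof.
move=> [_ f_lip] z; apply/(@cvgrPdist_lt _ _ _ _ (nbhs_filter z)) => e e0.
have : euclid (z - w) @[w --> z] --> euclid (z - z).
  apply: (cvg_comp (fun w => z - w) (@euclid R k)); last exact: euclid_continuous.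
  apply: cvgB; [exact: (nbhs_filter z)| |exact: cvg_id].
  exact: (@cvg_cst _ _ _ (nbhs z) _).
rewrite subrr [X in _ --> X](_ : _ = 0); last first.
  by rewrite euclidE frob20 sqrtr0.
move=> /(@cvgrPdist_lt _ _ _ _ (nbhs_filter z))/(_ _ e0); apply: filterS => w.
by rewrite sub0r normrN ger0_norm ?euclid_ge0//; exact: le_lt_trans.
Qed.

(** For f in the unit ball, f (Q z) is bounded by 1 and Lipschitz with the
    constant |Q| <= c, so f (Q z) / c is again in the unit ball. This accounts for
    c * dBL m gamma; replacing Q by B under gamma costs the remaining term. *)
Lemma dBL_linear_image (m : set (borel 'cV[R]_k) -> \bar R) (Q B : 'M[R]_k)
    (c delta : R) n :
  (m set0 = 0)%E -> (forall A, (0 <= m A)%E) -> Q \in unitmx -> B \in unitmx ->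
  1 <= c -> Num.sqrt (frob2 Q) <= c ->
  Num.sqrt (frob2 (Q - B)) * n.+1%:R <= delta ->
  (dBL (pushforward m (linmap Q)) (pushforward gamma (linmap B))
    <= c%:E * dBL m gamma + (delta + 2 * mean (@tail R k n))%:E)%E.
Proof.
move=> m0 m_ge0 Qu Bu c1 Qc QB.
have c0 : 0 < c by rewrite (lt_le_trans ltr01).
have delta0 : 0 <= delta by apply: le_trans QB; rewrite mulr_ge0 ?sqrtr_ge0.
apply: ge_ereal_sup => _ [f fBL <-]; have [f1 f_lip] := fBL.
have cf := BL1_continuous fBL.
have cfm (A : 'M[R]_k) : continuous (fun z => f (A *m z)).
  by move=> z; apply: continuous_comp; [exact: mulmx_continuous|exact: cf].
rewrite !integral_linear_image//.
pose g z := c^-1 * f (Q *m z).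
have gBL : BL1 g.
  split=> [z|z w]; rewrite /g -?mulrBr normrM gtr0_norm ?invr_gt0// ler_pdivrMl//.
    by rewrite mulr1 (le_trans (f1 _)).
  apply: le_trans (f_lip _ _) _; rewrite -mulmxBr.
  apply: le_trans (euclid_mul _ _) _.
  by rewrite ler_wpM2r// euclid_ge0.
have fg z : f (Q *m z) = c * g z by rewrite /g mulVKf// gt_eqF.
have -> : (\int[m]_z (f (Q *m z))%:E = c%:E * \int[m]_z (g z)%:E)%E.
  by rewrite -integralZ_setfun//; under eq_fun do rewrite fg.
have close : `|mean (fun z => f (Q *m z)) - mean (fun z => f (B *m z))|
    <= delta + 2 * mean (@tail R k n).
  apply: (le_mean_tail (M := 1)) => // z.
  have [nz|zn] := leP n.+1%:R (euclid z).
    rewrite tail_out// mulr1; apply: le_trans (ler_normB _ _) _.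
    by have := f1 (Q *m z); have := f1 (B *m z); lra.
  apply: (@le_trans _ _ delta); last by rewrite lerDl mulr_ge0// tail_ge0.
  apply: le_trans QB; apply: le_trans (f_lip _ _) _.
  rewrite -mulmxBl; apply: le_trans (euclid_mul _ _) _.
  by rewrite ler_wpM2l ?sqrtr_ge0// ltW.
have cg : continuous g by exact: BL1_continuous.
have gamma_f : mean (fun z => f (Q *m z)) = c * mean g.
  rewrite -RintegralZl//; last exact: (bounded_continuous_integrable gamma cg gBL.1).
  by apply: eq_Rintegral => z _; exact: fg.
have dBL_g : (`| \int[m]_z (g z)%:E - (mean g)%:E | <= dBL m gamma)%E.
  by apply: ereal_sup_ubound; exists g => //; rewrite (integral_mean gamma cg gBL.1).
rewrite (integral_mean gamma (cfm B) (fun z => f1 _)).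
move: close; rewrite gamma_f => close.
apply: le_trans (leeD (lee_wpmul2l _ dBL_g) (lexx _)); last by rewrite lee_fin ltW.
case: (\int[m]_z (g z)%:E)%E => [a| |] /=.
- rewrite -EFinM -EFinD lee_fin.
  have -> : c * `|a - mean g| = `|c * a - c * mean g|.
    by rewrite -mulrBr normrM (gtr0_norm c0).
  rewrite -[X in `|X|](_ : (c * a - c * mean g) +
    (c * mean g - mean (fun z => f (B *m z))) = _); last by rewrite addrA subrK.
  by apply: le_trans (ler_normD _ _) _; rewrite lerD2l.
- by rewrite !gt0_muley ?lte_fin//= leey.
- by rewrite gt0_muleNy ?gt0_muley ?lte_fin//= leey.
Qed.

Context d (Omega : measurableType d) (P : probability Omega R).
Context (Q : nat -> 'M[R]_k) (B : 'M[R]_k).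
Hypothesis QB : Q N @[N --> \oo] --> B.
Hypothesis Bu : B \in unitmx.

(** Eventually the event dBL (nu N) > eps is contained in the event
    dBL (mu N) > eps / (2 c), by [dBL_linear_image]. *)
Lemma weak_cvg_linear_image
    (mu nu : nat -> Omega -> set (borel 'cV[R]_k) -> \bar R) :
  (forall N w, (mu N w set0 = 0)%E) -> (forall N w A, (0 <= mu N w A)%E) ->
  (\forall N \near \oo, Q N \in unitmx /\
    forall w, nu N w = pushforward (mu N w) (linmap (Q N))) ->
  weak_cvg_in_prob P mu gamma ->
  weak_cvg_in_prob P nu (pushforward gamma (linmap B)).
Proof.
move=> mu0 mu_ge0 nuE mu_cvg eps eps0.
(* the errors c * (eps / (2 * c)), eps / 4 and 2 * (eps / 8) sum to eps *)
have [n tail_n] := tail_mean_small gamma (divr_gt0 eps0 (@ltr0n R 8)).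
pose c := Num.sqrt (frob2 B) + 1.
have c1 : 1 <= c by rewrite lerDr sqrtr_ge0.
have c0 : 0 < c by exact: lt_le_trans c1.
have Q_norm : Num.sqrt (frob2 (Q N)) @[N --> \oo] --> Num.sqrt (frob2 B).
  apply: (cvg_comp _ Num.sqrt (cvg_frob2 _ QB)); exact: sqrt_continuous.
have QB_norm : Num.sqrt (frob2 (Q N - B)) * n.+1%:R @[N --> \oo] --> (0 : R).
  rewrite -(mul0r n.+1%:R); apply: cvgM; last exact: cvg_cst.
  have <- : Num.sqrt (frob2 (B - B)) = 0.
    by rewrite subrr frob20 sqrtr0.
  apply: (cvg_comp _ Num.sqrt (cvg_frob2 _ _)); last exact: sqrt_continuous.
  by apply: cvgB; [exact: QB|exact: cvg_cst].
have eps4 : 0 < eps / 4 by rewrite divr_gt0.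
have eps2c : 0 < eps / (2 * c) by rewrite divr_gt0// mulr_gt0.
apply: (squeeze_cvge _ (cvg_cst 0%E) (mu_cvg _ eps2c)).
near=> N; rewrite mu_ext_ge0//=; apply: le_mu_ext => w /=; apply: contraTT.
rewrite -!leNgt => small.
have [QNu ->] : Q N \in unitmx /\
    forall w, nu N w = pushforward (mu N w) (linmap (Q N)) by near: N.
have QNc : Num.sqrt (frob2 (Q N)) <= c.
  by near: N; apply: (cvgr_le _ Q_norm); rewrite ltrDl.
have QNB : Num.sqrt (frob2 (Q N - B)) * n.+1%:R <= eps / 4.
  by near: N; exact: (cvgr_le _ QB_norm).
apply: le_trans (dBL_linear_image (mu0 N w) (mu_ge0 N w) QNu Bu c1 QNc QNB) _.
apply: le_trans (leeD (lee_wpmul2l _ small) (lexx _)) _.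
  by rewrite lee_fin ltW.
rewrite -EFinM -EFinD lee_fin.
have -> : c * (eps / (2 * c)) = eps / 2 by field; rewrite gt_eqF.
by move: tail_n; lra.
Unshelve. all: by end_near. Qed.

(** The map (z, N) |-> f (Q_N z) - f (B z) tends to 0 as z tends to any point
    and N to infinity; compactness of the ball makes this uniform in z. *)
Lemma linear_unif_compact (f : 'cV[R]_k -> R) (r delta : R) :
  continuous f -> 0 < delta ->
  \forall N \near \oo, forall z, euclid z <= r ->
    `|f (Q N *m z) - f (B *m z)| <= delta.
Proof.
move=> cf delta0.
have /compact_near_coveringP cover := @euclid_ball_compact R k r.
apply: (cover nat \oo (fun N z => `|f (Q N *m z) - f (B *m z)| <= delta)) => z _.
have fQ : f (Q p.2 *m p.1) @[p --> (nbhs z, nbhs \oo)] --> f (B *m z).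
  apply: (cvg_comp (fun p : 'cV[R]_k * nat => Q p.2 *m p.1) f); last exact: cf.
  apply: cvg_mulmx; last exact: cvg_fst.
  by apply: (cvg_comp snd Q); [exact: cvg_snd|exact: QB].
have fB : f (B *m p.1) @[p --> (nbhs z, nbhs (\oo : set_system nat))] --> f (B *m z).
  apply: (cvg_comp (fun p : 'cV[R]_k * nat => B *m p.1) f); last exact: cf.
  apply: (cvg_comp fst (mulmx B)); first exact: cvg_fst.
  exact: mulmx_continuous.
have FF : Filter (filter_prod (nbhs z) (nbhs (\oo : set_system nat))).
  exact: filter_prod_filter.
have := @cvgB _ _ _ _ FF _ _ _ _ fQ fB; rewrite subrr.
by move=> /(@cvgr0Pnorm_le _ _ _ _ FF)/(_ _ delta0).
Qed.

(** Slutsky's lemma by a sandwich: f (Q_N z) lies between the two functions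
    f (B z) -+ (eta / 4 + 2 M tail n z), which do not depend on N and are bounded
    and continuous, so that their integrals at Z_N converge by hypothesis. The
    comparison of the integrals only uses monotonicity. *)
Lemma cvg_in_dist_linear_image (Z Z' : nat -> Omega -> 'cV[R]_k) :
  (\forall N \near \oo, forall w, Z' N w = Q N *m Z N w) ->
  cvg_in_dist P Z gamma ->
  cvg_in_dist P Z' (pushforward gamma (linmap B)).
Proof.
move=> Z'E Z_cvg f cf [M fM].
have M0 : 0 <= M by exact: le_trans (fM 0).
have cfB : continuous (fun z => f (B *m z)).
  by move=> z; apply: continuous_comp; [exact: mulmx_continuous|exact: cf].
rewrite integral_linear_image// (integral_mean gamma cfB (fun z => fM _)).
set F := Rintegral _ _ _.
apply: ereal_cvg_approx => eta eta0.
(* a mean tail below eta / (8 * (M + 1)) contributes at most eta / 4, also if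
   M = 0 *)
have M8 : 0 < 8 * (M + 1) by rewrite mulr_gt0// ltr_wpDl.
have [n tail_n] := tail_mean_small gamma (divr_gt0 eta0 M8).
have tail_M : 2 * M * mean (@tail R k n) <= eta / 4.
  have tail0 : 0 <= mean (@tail R k n).
    by apply: Rintegral_ge0 => z _; exact: tail_ge0.
  move: tail_n; rewrite ltr_pdivlMr// => tail_n.
  by nra.
pose u (s : R) z := f (B *m z) + s * (eta / 4 + 2 * M * tail n z).
have cu s : continuous (u s).
  apply: continuous_addf => //; apply: continuous_scalef.
  apply: continuous_addf; first exact: cst_continuous.
  by apply: continuous_scalef; exact: tail_continuous.
have uM s z : `|u s z| <= M + `|s| * (eta / 4 + 2 * M).
  apply: le_trans (ler_normD _ _) _; apply: lerD; first exact: fM.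
  rewrite normrM ler_wpM2l// ger0_norm; last first.
    by rewrite addr_ge0 ?divr_ge0 ?(ltW eta0)// !mulr_ge0// tail_ge0.
  by rewrite lerD2l ler_piMr ?tail_le1// mulr_ge0.
have mean_u s : `|s| = 1 -> `|mean (u s) - F| <= eta / 2.
  move=> s1.
  have := @le_mean_tail (u s) (fun z => f (B *m z))
    (M + `|s| * (eta / 4 + 2 * M)) (eta / 4) (2 * M) n.
  move=> /(_ (cu s) cfB (uM s)) close.
  apply: le_trans (close _ _) _ => [z|z|].
  - apply: le_trans (fM _) _; rewrite lerDl mulr_ge0// addr_ge0//.
      by rewrite divr_ge0 ?(ltW eta0).
    by rewrite mulr_ge0.
  - rewrite /u addrAC subrr add0r normrM s1 mul1r ger0_norm//.
    by rewrite addr_ge0 ?divr_ge0 ?(ltW eta0)// !mulr_ge0// tail_ge0.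
  - by lra.
have u_cvg s : fine (\int[P]_w (u s (Z N w))%:E)%E @[N --> \oo] --> mean (u s) /\
    \forall N \near \oo, (\int[P]_w (u s (Z N w))%:E)%E \is a fin_num.
  have := Z_cvg (u s) (cu s) (ex_intro _ _ (uM s)).
  by rewrite (integral_mean gamma (cu s) (uM s)) => /fine_cvgP[].
have eta2 : 0 < eta / 2 by rewrite divr_gt0.
have near_Q := @linear_unif_compact f n.+1%:R (eta / 4) cf.
near=> N.
have Z'N w : Z' N w = Q N *m Z N w by move: w; near: N.
have close z : euclid z <= n.+1%:R -> `|f (Q N *m z) - f (B *m z)| <= eta / 4.
  by move: z; near: N; apply: near_Q; rewrite divr_gt0.
have sandwich z : `|f (Q N *m z) - f (B *m z)| <= eta / 4 + 2 * M * tail n z.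
  have [zn|nz] := leP (euclid z) n.+1%:R.
    by apply: le_trans (close z zn) _; rewrite lerDl !mulr_ge0// tail_ge0.
  rewrite (tail_out (ltW nz)) mulr1; apply: le_trans (ler_normB _ _) _.
  by have := fM (Q N *m z); have := fM (B *m z); lra.
have /andP[lo_fin lo_mean] : ((\int[P]_w (u (-1) (Z N w))%:E)%E \is a fin_num) &&
    (mean (u (-1)) - eta / 2 <= fine (\int[P]_w (u (-1) (Z N w))%:E)%E).
  apply/andP; split; near: N; first exact: (u_cvg (-1)).2.
  by apply: (cvgr_ge _ (u_cvg (-1)).1); rewrite gtrBl.
have /andP[up_fin up_mean] : ((\int[P]_w (u 1 (Z N w))%:E)%E \is a fin_num) &&
    (fine (\int[P]_w (u 1 (Z N w))%:E)%E <= mean (u 1) + eta / 2).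
  apply/andP; split; near: N; first exact: (u_cvg 1).2.
  by apply: (cvgr_le _ (u_cvg 1).1); rewrite ltrDl.
apply/andP; split.
- apply: (@le_trans _ _ (\int[P]_w (u (-1) (Z N w))%:E)%E); last first.
    apply: le_integral_setfun => w; rewrite Z'N /u mulN1r.
    by have := sandwich (Z N w); rewrite ler_distl => /andP[].
  rewrite -(fineK lo_fin) lee_fin; apply: le_trans lo_mean.
  have := mean_u (-1) (normrN1 _); rewrite ler_distl => /andP[+ _].
  by lra.
- apply: (@le_trans _ _ (\int[P]_w (u 1 (Z N w))%:E)%E).
    apply: le_integral_setfun => w; rewrite Z'N /u mul1r.
    by have := sandwich (Z N w); rewrite ler_distl => /andP[_].
  rewrite -(fineK up_fin) lee_fin; apply: le_trans up_mean _.
  have := mean_u 1 (normr1 _); rewrite ler_distl => /andP[_].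
  by lra.
Unshelve. all: by end_near. Qed.

End linear_images.

(** * Asymptotic normality in the original scale *)

Theorem theorem2p6 (R : realType)
  (dim : nat) (X : set (Rn R dim)) (mX : measurable X)
  (X_gt0 : (0 < lebesgue_Rn R dim X)%E) (X_fin : (lebesgue_Rn R dim X < +oo)%E)
  (H : completeNormedModType R) (dotH : {dot H for idfun})
  (dotH_norm : forall h, dotH h h = `|h| ^+ 2)
  (e : nat -> H) (e_basis : orthonormal_basis dotH e)
  (Theta : set H) (Theta_sub : linear_subspace Theta)
  (Theta_e : forall n, ED e n `<=` Theta)
  (V : normedModType R) (dotV : {dot V for idfun})
  (dotV_norm : forall v, dotV v v = `|v| ^+ 2)
  (V_findim : exists n (b : 'I_n -> V), lin_span b = setT)
  (G : H -> Rn R dim -> V)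
  (G_meas : measurable_forward_map X (uniform_on mX) Theta G)
  (d : measure_display) (Omega : measurableType d) (P : probability Omega R)
  (Xs : nat -> {RV P >-> Rn R dim}) (eps : nat -> {RV P >-> borel V})
  (Xs_X : forall i w, X (Xs i w))
  (Xs_law : forall i A, measurable A -> distribution P (Xs i) A = uniform_on mX A)
  (eps_law : forall i, std_gaussian_on setT dotV (distribution P (eps i)))
  (indep : design_noise_independent Xs eps)
  (th0 : H) (th0_Theta : Theta th0)
  (k : nat) (psi : 'I_k -> H) (psi_indep : lin_indep psi)
  (D : nat -> nat) (D_oo : D @ \oo --> \oo)
  (dotN : nat -> H -> H -> R)
  (dotN_inner : forall N, inner_product_on (ED e (D N)) (dotN N))
  (Pi : nat -> probability (borel H) R)
  (Pi_gauss : forall N, std_gaussian_on (ED e (D N)) (dotN N) (Pi N))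
  (T : H -> Rn R dim -> V)
  (T_op : bounded_linear_op X (uniform_on mX) T)
  (T_lin : linearized_at X (uniform_on mX) Theta G th0 T)
  (Tadj : (Rn R dim -> V) -> H)
  (Tadj_adj : is_adjoint X (uniform_on mX) dotV dotH T Tadj)
  (info_inv : forall n, set_bij (ED e n) (ED e n)
                (infoD dotH e (information_op T Tadj) n))
  (phi : 'I_k -> H)
  (phi_psi : forall i, information_op T Tadj (phi i) = psi i)
  (phi_approx :
    (\big[Num.max/0]_(i < k) `|phi i - PE dotH e (D N) (phi i)|)
      / lambda_min dotH e (information_op T Tadj) (D N)
    @[N --> \oo] --> (0 : R))
  (T_inj : forall h1 h2 : H, lin_span phi h1 -> lin_span phi h2 ->
    ae_eq (uniform_on mX) X (T h1) (T h2) -> h1 = h2) :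
  let L : 'M[R]_k := \matrix_(i, j) dotH (phi i) (psi j) in
  let i_ N : 'M[R]_k := iD dotH e (information_op T Tadj) psi (D N) in
  let post N w := posterior (ED e (D N)) (Pi N)
                    (loglik Xs G (obs Xs eps G th0) N w) in
  let hPsi N w : 'cV[R]_k := PsiMean dotH psi (post N w) in
  let rN N : R := Num.sqrt N%:R in
  invmx (i_ N) @[N --> \oo] --> L /\
  (weak_cvg_in_prob P
     (fun N w => pushforward (post N w) (fun th : borel H =>
        rN N *: (mxsqrt (i_ N) *m (Psi dotH psi th - hPsi N w)) : borel 'cV[R]_k))
     (gauss 1%:M) ->
   cvg_in_dist P
     (fun N w => rN N *: (mxsqrt (i_ N) *m (hPsi N w - Psi dotH psi th0)))
     (gauss 1%:M) ->
   weak_cvg_in_prob P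
     (fun N w => pushforward (post N w) (fun th : borel H =>
        rN N *: (Psi dotH psi th - hPsi N w) : borel 'cV[R]_k))
     (gauss L) /\
   cvg_in_dist P
     (fun N w => rN N *: (hPsi N w - Psi dotH psi th0))
     (gauss L)).
Proof.
move=> L i_ post hPsi rN.
set I := information_op T Tadj in info_inv phi_psi phi_approx i_ *.
have I_sym h g : dotH (I h) g = dotH (I g) h.
  exact: (information_sym T_op Tadj_adj).
have I_ge0 h : 0 <= dotH (I h) h.
  exact: (information_ge0 dotV_norm T_op Tadj_adj).
have [K I_bounded] : exists K : R, forall h, dotH (I h) h <= K ^+ 2 * `|h| ^+ 2.
  exact: (information_bounded dotV_norm T_op Tadj_adj).
have infoD_inj n : {in ED e n &, injective (infoD dotH e I n)}.
  by have [_ ? _] := info_inv n.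
have iL : invmx (i_ N) @[N --> \oo] --> L.
  exact: (galerkin_cvg dotH_norm e_basis I_sym I_ge0 I_bounded infoD_inj
    phi_psi D_oo).
split; first exact: iL.
move=> post_cvg mean_cvg.
have i_psd N : psdmx (invmx (i_ N)).
  by rewrite invmxK; exact: (galerkin_psd e_basis.1 I_sym I_ge0 phi_psi).
have L_psd : psdmx L by exact: (info_gram_psd I_sym I_ge0 phi_psi).
have L_unit : L \in unitmx.
  exact: (info_gram_unit dotH_norm I_sym I_ge0 phi_psi psi_indep).
have sqrtL_unit : mxsqrt L \in unitmx.
  by have [_ LL] := mxsqrtP L_psd; exact: sqrt_unitmx LL L_unit.
pose Q N := invmx (mxsqrt (i_ N)).
have QL : Q N @[N --> \oo] --> mxsqrt L.
  have := inv_mxsqrt_cvg i_psd L_psd L_unit iL.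
  by under eq_cvg do rewrite invmxK.
have sqrt_unit : \forall N \near \oo, mxsqrt (i_ N) \in unitmx.
  apply: filterS (near_unitmx L_unit iL) => N iu.
  by have [] := inv_mxsqrt_inv (i_psd N) iu; rewrite invmxK.
have QK N (v : 'cV[R]_k) : mxsqrt (i_ N) \in unitmx ->
    Q N *m (rN N *: (mxsqrt (i_ N) *m v)) = rN N *: v.
  by move=> iu; rewrite -scalemxAr mulKmx.
have [gamma [gamma1 gammaL]] := gauss1_probability R k.
move: post_cvg mean_cvg; rewrite gamma1 gammaL => post_cvg mean_cvg; split.
- apply: (weak_cvg_linear_image QL sqrtL_unit _ _ _ post_cvg).
  + by move=> N w; exact: posterior_set0.
  + by move=> N w A; exact: posterior_ge0.
  + apply: filterS sqrt_unit => N iu; split=> [|w]; first by rewrite unitmx_inv.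
    apply/funext => A; rewrite /pushforward; congr (post N w _).
    by apply/seteqP; split=> th /=; rewrite QK.
- apply: (cvg_in_dist_linear_image QL sqrtL_unit _ mean_cvg).
  by apply: filterS sqrt_unit => N iu w; rewrite QK.
Qed.
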